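(* Let $n \geq 3$. For every $2$-dimensional linear subspace $H$ of $\mathbb{R}^n$ one has \[ \mathrm{vol}_2(B_1^n \cap H) \geq \frac{n^2\sin^3\left(\frac{\pi}{2n}\right)}{\cos\left(\frac{\pi}{2n}\right)}. \] Moreover, if equality holds, then $B_1^n \cap H$ is isometric to a regular $2n$-gon in $\mathbb{R}^2$. The minimum is achieved for $H = T(\mathbb{R}^2)$, where $T:\mathbb{R}^2\to\mathbb{R}^n$ is given by $Tx = (\langle v_1,x\rangle,\ldots,\langle v_n,x\rangle)$ with $v_k = (\cos(\frac{k\pi}{n}),\sin(\frac{k\pi}{n}))$, $k=1,\ldots,n$. The minimising subspace $H$ is unique, up to coordinate reflections and permutations of coordinates in $\mathbb{R}^n$.
   Context: $B_1^n=\{x\in\mathbb{R}^n:\sum_{i=1}^n|x_i|\le 1\}$ is the $n$-dimensional cross-polytope; $\mathrm{vol}_2$ denotes the $2$-dimensional Lebesgue measure on the subspace $H$; $\langle\cdot,\cdot\rangle$ is the standard inner product. Coordinate reflections are the maps changing the signs of some coordinates. *)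

(* Defs.v *)
From HB Require Import structures.
From mathcomp Require Import all_boot all_order all_algebra all_fingroup.
From mathcomp Require Import all_classical all_reals all_analysis.

Set Implicit Arguments.
Unset Strict Implicit.
Unset Printing Implicit Defensive.

Import Order.TTheory GRing.Theory Num.Theory.
Import numFieldNormedType.Exports.

Local Open Scope classical_set_scope.
Local Open Scope ring_scope.

Section Definitions.
Variable R : realType.

Definition dot n (x y : 'rV[R]_n) : R := \sum_(i < n) x 0 i * y 0 i.

(* The norm that the library puts on 'rV[R]_n is the sup norm, hence the
   explicit Euclidean distance. *)
Definition edist n (x y : 'rV[R]_n) : R := Num.sqrt (dot (x - y) (x - y)).

Definition isometric m n (A : set 'rV[R]_m) (B : set 'rV[R]_n) : Prop :=
  exists2 f : 'rV[R]_m -> 'rV[R]_n,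
    forall x y, A x -> A y -> edist (f x) (f y) = edist x y & f @` A = B.

Definition cross_polytope n : set 'rV[R]_n :=
  [set x | \sum_(i < n) `|x 0 i| <= 1].

Definition section n (H : {vspace 'rV[R]_n}) : set 'rV[R]_n :=
  @cross_polytope n `&` [set` H].

Definition orthonormal_basis n (H : {vspace 'rV[R]_n})
    (b : 'rV[R]_n * 'rV[R]_n) : Prop :=
  [/\ dot b.1 b.1 = 1, dot b.2 b.2 = 1, dot b.1 b.2 = 0 &
      (<[b.1]> + <[b.2]>)%VS = H].

(* Lebesgue measure on a plane H, as the image of the Lebesgue measure of the
   plane R * R under the isometry (s, t) |-> s b1 + t b2 onto H.  Planar
   Lebesgue measure is invariant under orthogonal maps, so the value does not
   depend on the orthonormal basis that [get] selects; such a basis exists as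
   soon as \dim H = 2. *)
Definition vol2 n (H : {vspace 'rV[R]_n}) (A : set 'rV[R]_n) : \bar R :=
  let b := get (orthonormal_basis H) in
  (lebesgue_measure \x lebesgue_measure)%E
    [set p : R * R | A (p.1 *: b.1 + p.2 *: b.2)].

Definition dir (t : R) : 'rV[R]_2 :=
  \row_(j < 2) (if j == 0 then cos t else sin t).

Definition convex_hull m n (p : 'I_m -> 'rV[R]_n) : set 'rV[R]_n :=
  [set x | exists w : 'I_m -> R,
    [/\ forall k, 0 <= w k, \sum_k w k = 1 & x = \sum_k w k *: p k]].

(* The polygon is the filled one: convex hull of its m vertices, equally spaced
   on a circle of centre c and radius r > 0. *)
Definition regular_polygon m (P : set 'rV[R]_2) : Prop :=
  exists (c : 'rV[R]_2) (r t : R), 0 < r /\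
    P = convex_hull
          (fun k : 'I_m => c + r *: dir (t + 2 * pi * k%:R / m%:R)).

(* Index k : 'I_n stands for the (k+1)-st coordinate, whence [k.+1]. *)
Definition Tmap n (x : 'rV[R]_2) : 'rV[R]_n :=
  \row_(k < n) dot (dir (k.+1%:R * pi / n%:R)) x.

Fact Tmap_is_linear n : linear (@Tmap n).
Proof.
move=> a x y; apply/rowP => k; rewrite !mxE /dot mulr_sumr -big_split /=.
by apply: eq_bigr => i _; rewrite !mxE mulrDr mulrCA.
Qed.
HB.instance Definition _ n :=
  GRing.isLinear.Build R 'rV[R]_2 'rV[R]_n _ (@Tmap n) (@Tmap_is_linear n).

Definition Timage n : {vspace 'rV[R]_n} := limg (linfun (@Tmap n)).

Definition min_volume n : R :=
  n%:R ^+ 2 * sin (pi / (2 * n%:R)) ^+ 3 / cos (pi / (2 * n%:R)).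

Definition minimising n (H : {vspace 'rV[R]_n}) : Prop :=
  \dim H = 2%N /\
  forall K : {vspace 'rV[R]_n}, \dim K = 2%N ->
    (vol2 H (section H) <= vol2 K (section K))%E.

Definition coord_reflection n (e : 'I_n -> bool) (x : 'rV[R]_n) : 'rV[R]_n :=
  \row_i ((-1) ^+ e i * x 0 i).

Definition signed_perm_equivalent n (H K : {vspace 'rV[R]_n}) : Prop :=
  exists (e : 'I_n -> bool) (s : 'S_n),
    [set` K] = (fun x => coord_reflection e (col_perm s x)) @` [set` H].

End Definitions.

Arguments Timage : clear implicits.
Arguments min_volume : clear implicits.

(* Main.v *)
Require Import Defs.
From HB Require Import structures.
From mathcomp Require Import all_boot all_order all_algebra all_fingroup.
From mathcomp Require Import all_classical all_reals all_analysis measurable_realfun.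
From mathcomp Require Import ring lra.

Set Implicit Arguments.
Unset Strict Implicit.
Unset Printing Implicit Defensive.

Import Order.TTheory GRing.Theory Num.Theory.
Import numFieldNormedType.Exports.

Local Open Scope classical_set_scope.
Local Open Scope ring_scope.

(** An orthonormal basis of H identifies the section with the unit ball, in the
    plane, of the norm N(p) = sum_i |<u_i, p>|, where u_i collects the i-th
    coordinates of the two basis vectors and sum_i |u_i|^2 = 2.  Up to signs and
    a permutation of the coordinates, <u_i, p> = r_i det(e(f_i), p), where
    e(t) = (cos t, sin t) and the angles increase f_0 <= ... <= f_(n-1) <= f_n
    := f_0 + pi.  On the sector between e(f_j) and e(f_(j+1)) no term changes
    sign, so that N is linear there: the ball is a polygon made of the triangles
    with vertices 0, e(f_j)/h_j, e(f_(j+1))/h_(j+1) and their opposites, where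
    h_j = N(e(f_j)).  With d_j = f_(j+1) - f_j its area is the sum of the terms
    sin(d_j)/(h_j h_(j+1)).

    Two linear constraints bind the pieces: sum_j d_j = pi, and, writing
    I_j = (h_j + h_(j+1)) tan(d_j/2), which is the integral of N(e(t)) over the
    sector, sum_j I_j = 2 sum_i r_i <= 2 sqrt(2n) (lemma [sum_heights_tan] and
    Cauchy-Schwarz).  The means inequality bounds each term of the area below by
    (2 F(d_j/2))^3 / I_j^2, where F(x) = sin x / (cos x)^(1/3), hence by an
    affine function of F(d_j/2) and I_j ([sector_bound]).  Since F is strictly
    convex on [0, pi/2[ ([profile_tangent]), summation gives
    n^2 F(pi/(2n))^3, which is the announced bound ([fan_inequality]).

    Equality forces every d_j to be pi/n and every r_i to be sqrt(2/n).  Then N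
    is determined up to a rotation, which makes the section a regular 2n-gon
    ([zonorm_in_polygon], [in_polygon_zonorm]) and H unique up to signs and
    permutations ([regular_frame_equivalent]).  Conversely the plane of the
    statement attains the bound: there the n directions are equally spaced, so
    all the h_j agree and are computed by the second constraint
    ([vol2_Timage_le]). *)

(** * Linear changes of variables for planar Lebesgue measure *)

Section PlaneMeasure.
Variable R : realType.

Local Notation mu := (@lebesgue_measure R).

Lemma lebesgue_measure_affine (c d : R) (A : set R) : d != 0 -> measurable A ->
  mu ((fun y => c + d * y) @^-1` A) = (`|d|^-1%:E * mu A)%E.
Proof.
move=> d0 mA.
pose g : measurableTypeR R -> measurableTypeR R := fun y : R => c + d * y.
have mg : measurable_fun setT g.
  apply: (@measurable_funD _ _ _ _ (cst c) (fun y : R => d * y)) => //.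
  exact: mulrl_measurable.
have nd : 0 < `|d| by rewrite normr_gt0.
pose k : {nonneg R} := NngNum (ltW nd).
pose m : {measure set (measurableTypeR R) -> \bar R} := mscale k (pushforward mu g).
have -> : mu A = m mg A.
  apply: lebesgue_measure_unique => //= _ [[a b]] _ <-.
  rewrite /m/= /mscale/= /pushforward /=.
  have [d_gt0|d_lt0|] := ltrgt0P d; last by move/eqP; rewrite (negbTE d0).
    have -> : g @^-1` `]a, b] = `](a - c) / d, (b - c) / d]%classic.
      apply/seteqP; split => y /=; rewrite /g !in_itv/= ltr_pdivrMr// ler_pdivlMr//;
        rewrite ltrBlDr lerBrDr (mulrC y) (addrC _ c)//.
    rewrite !lebesgue_measure_itv/= !lte_fin ltr_pM2r ?invr_gt0// ltrD2r.
    case: ifPn => _; last by rewrite mule0.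
    by rewrite -!EFinD -EFinM; congr (_%:E); field.
  have -> : g @^-1` `]a, b] = `[(b - c) / d, (a - c) / d[%classic.
    apply/seteqP; split => y /=; rewrite /g !in_itv/= ltr_ndivlMr// ler_ndivrMr//;
    rewrite ltrBlDr lerBrDr (mulrC y) (addrC _ c) andbC//.
  rewrite !lebesgue_measure_itv/= !lte_fin ltr_nM2r ?invr_lt0// ltrD2r.
  case: ifPn => _; last by rewrite mule0.
  by rewrite -!EFinD -EFinM; congr (_%:E); field.
rewrite /m/= /mscale/= muleA -EFinM mulVf ?mul1e//; exact: lt0r_neq0.
Qed.

Local Notation mu2 := (@product_measure1 _ _ (measurableTypeR R) (measurableTypeR R) R
  (@lebesgue_measure R) (@lebesgue_measure R)).
Local Notation mR := (measurableTypeR R).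

Lemma measurable_linear_form (a b : R) :
  measurable_fun setT (fun p : (mR * mR)%type => a * p.1 + b * p.2 : mR).
Proof.
apply: measurable_funD; apply: measurable_funM => //.
Qed.

Lemma measurable_linear2 (a b c d : R) :
  measurable_fun setT
    (fun p : (mR * mR)%type => (a * p.1 + b * p.2, c * p.1 + d * p.2) : (mR * mR)%type).
Proof.
by apply/measurable_fun_pairP; split; exact: measurable_linear_form.
Qed.

Lemma measurable_preimage_linear2 (a b c d : R) (A : set (mR * mR)) :
  measurable A ->
  measurable ((fun p : (mR * mR)%type => (a * p.1 + b * p.2, c * p.1 + d * p.2)) @^-1` A).
Proof.
by move=> mA; rewrite -[X in measurable X]setTI; exact: measurable_linear2.
Qed.

(** On each vertical line the map is affine, so Fubini reduces to dimension one. *)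
Lemma mu2_shear (c d : R) (A : set (mR * mR)) : d != 0 -> measurable A ->
  mu2 ((fun p => (p.1, c * p.1 + d * p.2)) @^-1` A) = (`|d|^-1%:E * mu2 A)%E.
Proof.
move=> d0 mA; rewrite /product_measure1 -ge0_integralZl//; last first.
- exact: measurable_fun_xsection.
apply: eq_integral => x _ /=.
rewrite -(@lebesgue_measure_affine (c * x) d)//; last exact: measurable_xsection.
Qed.

Lemma measurable_swap :
  measurable_fun setT (fun p : (mR * mR)%type => (p.2, p.1) : (mR * mR)%type).
Proof.
apply/measurable_fun_pairP; split; [exact: measurable_snd|exact: measurable_fst].
Qed.

Lemma mu2_swap (A : set (mR * mR)) : measurable A ->
  mu2 ((fun p => (p.2, p.1)) @^-1` A) = mu2 A.
Proof.
move=> mA.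
rewrite [RHS](@product_measure_unique _ _ _ _ _ _ _
  ((fun m => pushforward mu2 (fun p : (mR * mR)%type => (p.2, p.1) : (mR * mR)%type)
     : {measure set _ -> \bar R}) measurable_swap))//.
move=> B C mB mC /=; rewrite /pushforward.
have -> : (fun p : (mR * mR)%type => (p.2, p.1)) @^-1` (B `*` C) = C `*` B.
  by apply/seteqP; split => -[x y] /= [].
by rewrite [LHS]product_measure1E// muleC.
Qed.

(** An invertible matrix is a product of coordinate swaps and of maps that fix
    the first coordinate. *)
Lemma mu2_linear (a b c d : R) (A : set (mR * mR)) :
  a * d - b * c != 0 -> measurable A ->
  mu2 ((fun p => (a * p.1 + b * p.2, c * p.1 + d * p.2)) @^-1` A)
  = (`|a * d - b * c|^-1%:E * mu2 A)%E.
Proof.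
(* If d = 0 then c != 0, and swapping the two variables brings c in place of d. *)
wlog d0 : a b c d A / d != 0 => [hw|] D0 mA.
  have [d0|/hw] := eqVneq d 0; last exact.
  have c0 : c != 0 by apply: contraNneq D0 => ->; rewrite d0 !mulr0 subrr.
  have D0' : b * c - a * d != 0 by rewrite -opprB oppr_eq0.
  rewrite -normrN opprB -hw// -[RHS]mu2_swap; last exact: measurable_preimage_linear2.
  congr (mu2 _); apply/seteqP; split => p /=; by rewrite ![_ + _ * p.1]addrC.
pose D := a * d - b * c.
pose B : set (mR * mR) := [set p | A (D / d * p.1 + b / d * p.2, p.2)].
have mB : measurable B.
  have := @measurable_preimage_linear2 (D / d) (b / d) 0 1 _ mA.
  by congr measurable; apply/seteqP; split => p /=; rewrite /B/= mul0r mul1r add0r.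
have D'0 : D / d != 0 by rewrite mulf_neq0// invr_eq0.
transitivity (mu2 ((fun p => (p.1, c * p.1 + d * p.2)) @^-1` B)).
  congr (mu2 _); rewrite /B; apply/seteqP; split => p /=;
    by congr A; congr (_, _); rewrite /D; field.
rewrite mu2_shear//.
pose C : set (mR * mR) := (fun p => (p.1, b / d * p.1 + D / d * p.2)) @^-1`
  ((fun p => (p.2, p.1)) @^-1` A).
transitivity (`|d|^-1%:E * mu2 C)%E.
  congr (_ * _)%E; rewrite -[LHS]mu2_swap//; congr (mu2 _).
  by apply/seteqP; split => p /=; rewrite /B /C/= addrC.
rewrite /C.
rewrite mu2_shear//; last first.
  by rewrite -[X in measurable X]setTI; exact: measurable_swap.
rewrite mu2_swap// muleA -EFinM; congr (_%:E * _)%E.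
rewrite normrM normfV invfM invrK mulrCA mulVf ?mulr1// normr_eq0//.
Qed.

Lemma integral_id01 (a b : bool) :
  (\int[lebesgue_measure]_(x in [set` Interval (BSide a 0%R) (BSide b (1%R : R))]) x%:E)%E = (2^-1)%:E.
Proof.
rewrite (@integral_itv_bndoo R 0 1 _ a b) //.
rewrite -(@integral_itv_bndoo R 0 1 _ true false)//.
have cF x : {for x, continuous (fun x : R => x ^+ 2 / 2)}.
  by apply: differentiable_continuous; apply/derivable1_diffP; exact: ex_derive.
rewrite (@continuous_FTC2 R idfun (fun x => x ^+ 2 / 2) 0 1)//.
- by rewrite -EFinB; congr EFin; lra.
- apply: continuous_subspaceT => x; exact: cvg_id.
- split.
  + by move=> x _; exact: ex_derive.
  + exact: (cvg_at_right_filter (cF 0)).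
  + exact: (cvg_at_left_filter (cF 1)).
- move=> x _; rewrite derive1E derive_val /=.
  rewrite /GRing.scale /=; lra.
Qed.

Lemma measurable_halfplane_lt (a b c : R) :
  measurable ([set p : mR * mR | 0 < c + (a * p.1 + b * p.2)] : set (mR * mR)).
Proof.
have : measurable_fun setT (fun p : mR * mR => c + (a * p.1 + b * p.2) : mR).
  by apply: measurable_funD => //; exact: measurable_linear_form.
move=> /(_ measurableT `]0, +oo[%classic (measurable_itv _)).
by rewrite setTI; congr measurable; apply/seteqP; split => p /=; rewrite in_itv/= andbT.
Qed.

Lemma measurable_halfplane_le (a b c : R) :
  measurable ([set p : mR * mR | 0 <= c + (a * p.1 + b * p.2)] : set (mR * mR)).
Proof.
have : measurable_fun setT (fun p : mR * mR => c + (a * p.1 + b * p.2) : mR).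
  by apply: measurable_funD => //; exact: measurable_linear_form.
move=> /(_ measurableT `[0, +oo[%classic (measurable_itv _)).
by rewrite setTI; congr measurable; apply/seteqP; split => p /=; rewrite in_itv/= andbT.
Qed.

Definition open_triangle : set (mR * mR) := [set p | [/\ 0 < p.1, 0 < p.2 & p.1 + p.2 < 1]].
Definition closed_triangle : set (mR * mR) := [set p | [/\ 0 <= p.1, 0 <= p.2 & p.1 + p.2 <= 1]].

Lemma measurable_open_triangle : measurable open_triangle.
Proof.
have := measurableI _ _ (measurable_halfplane_lt 1 0 0)
  (measurableI _ _ (measurable_halfplane_lt 0 1 0) (measurable_halfplane_lt (-1) (-1) 1)).
congr measurable; apply/seteqP; split => p /=; rewrite /open_triangle/=;
  [move=> [? []]|move=> []]; (repeat split); lra.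
Qed.

Lemma measurable_closed_triangle : measurable closed_triangle.
Proof.
have := measurableI _ _ (measurable_halfplane_le 1 0 0)
  (measurableI _ _ (measurable_halfplane_le 0 1 0) (measurable_halfplane_le (-1) (-1) 1)).
congr measurable; apply/seteqP; split => p /=; rewrite /closed_triangle/=;
  [move=> [? []]|move=> []]; (repeat split); lra.
Qed.

Lemma mu2_open_triangle : mu2 open_triangle = (2^-1)%:E.
Proof.
(* In the variables (w, y) = (x + y, y) the section at w is the interval from 0 to w. *)
transitivity (mu2 ((fun p => (1 * p.1 + -1 * p.2, 0 * p.1 + 1 * p.2)) @^-1` open_triangle)).
  rewrite mu2_linear ?mulr0 ?subr0 ?mulr1 ?normr1 ?invr1 ?mul1e ?oner_eq0//.
  exact: measurable_open_triangle.
rewrite -(integral_id01 false true) integral_mkcond /product_measure1.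
apply: eq_integral => x _; rewrite patchE /=.
have [/andP[x0 x1]|x01] := boolP (0 < x < 1).
  rewrite mem_set; last by rewrite /= in_itv/= x0.
  transitivity (lebesgue_measure (`]0, x[%classic : set R)).
    congr (lebesgue_measure _); rewrite set_itvE; apply/seteqP; split => y /=;
      rewrite /xsection/= !inE; first (by case=> /= ? ? ?; apply/andP; split; lra);
      by case/andP => ? ?; split => /=; lra.
  by rewrite lebesgue_measure_itv/= lte_fin x0 -EFinB subr0.
rewrite memNset; last by rewrite /= in_itv/=; exact/negP.
rewrite (_ : xsection _ _ = set0) ?measure0//.
rewrite -subset0 => y; rewrite /xsection/= inE; case=> /= ? ? ?.
by move/negP : x01; apply; apply/andP; split; lra.
Qed.

Lemma mu2_closed_triangle : mu2 closed_triangle = (2^-1)%:E.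
Proof.
transitivity (mu2 ((fun p => (1 * p.1 + -1 * p.2, 0 * p.1 + 1 * p.2)) @^-1` closed_triangle)).
  rewrite mu2_linear ?mulr0 ?subr0 ?mulr1 ?normr1 ?invr1 ?mul1e ?oner_eq0//.
  exact: measurable_closed_triangle.
rewrite -(integral_id01 true false) integral_mkcond /product_measure1.
apply: eq_integral => x _; rewrite patchE /=.
have [/andP[x0 x1]|x01] := boolP (0 <= x <= 1).
  rewrite mem_set; last by rewrite /= in_itv/= x0.
  transitivity (lebesgue_measure (`[0, x]%classic : set R)).
    congr (lebesgue_measure _); rewrite set_itvE; apply/seteqP; split => y /=;
      rewrite /xsection/= !inE; first (by case=> /= ? ? ?; apply/andP; split; lra);
      by case/andP => ? ?; split => /=; lra.
  rewrite lebesgue_measure_itv/= lte_fin -EFinB subr0.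
  by case: ltP => // x0'; congr EFin; apply/eqP; rewrite eq_le x0.
rewrite memNset; last by rewrite /= in_itv/=; exact/negP.
rewrite (_ : xsection _ _ = set0) ?measure0//.
rewrite -subset0 => y; rewrite /xsection/= inE; case=> /= ? ? ?.
by move/negP : x01; apply; apply/andP; split; lra.
Qed.

Lemma image_linear_preimage (a b c d : R) (A : set (mR * mR)) :
  a * d - b * c != 0 ->
  (fun p => (a * p.1 + b * p.2, c * p.1 + d * p.2)) @` A =
  (fun p => (d / (a * d - b * c) * p.1 + - b / (a * d - b * c) * p.2,
             - c / (a * d - b * c) * p.1 + a / (a * d - b * c) * p.2)) @^-1` A.
Proof.
move=> D0; apply/seteqP; split => [_ [[s t] Ast <-]|[x y] Axy].
  by rewrite /preimage /=; congr A : Ast; congr (_, _); field.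
exists (d / (a * d - b * c) * x + - b / (a * d - b * c) * y,
        - c / (a * d - b * c) * x + a / (a * d - b * c) * y) => //=.
by congr (_, _); field.
Qed.

Lemma measurable_image_linear (a b c d : R) (A : set (mR * mR)) :
  a * d - b * c != 0 -> measurable A ->
  measurable ((fun p : mR * mR => (a * p.1 + b * p.2, c * p.1 + d * p.2) : mR * mR) @` A).
Proof.
by move=> D0 mA; rewrite image_linear_preimage//; exact: measurable_preimage_linear2.
Qed.

Lemma mu2_image_linear (a b c d : R) (A : set (mR * mR)) :
  a * d - b * c != 0 -> measurable A ->
  mu2 ((fun p : mR * mR => (a * p.1 + b * p.2, c * p.1 + d * p.2) : mR * mR) @` A) =
  (`|a * d - b * c|%:E * mu2 A)%E.
Proof.
move=> D0 mA; rewrite image_linear_preimage// mu2_linear//; last first.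
  rewrite (_ : _ - _ = (a * d - b * c)^-1) ?invr_eq0//.
  by field.
congr (_%:E * _)%E; rewrite -normfV; congr `|_|; field.
exact: D0.
Qed.

End PlaneMeasure.

(** * A strictly convex function and the resulting inequality *)

Section Profile.
Variable R : realType.
Implicit Types (x y : R).

(** The function cos^(-1/3), where the cosine is positive. *)
Definition cos_cbrtV x : R := expR (- (ln (cos x)) / 3).
Local Notation g := cos_cbrtV.

Definition profile x : R := sin x * g x.

Definition profile' x : R := cos x * g x + sin x ^+ 2 * g x ^+ 4 / 3.

Lemma cos_cbrtV_gt0 x : 0 < g x. Proof. exact: expR_gt0. Qed.

Lemma cos_cbrtV3 x : 0 < cos x -> g x ^+ 3 = (cos x)^-1.
Proof.
move=> c0; rewrite /g -expRM_natl (_ : 3 * _ = - ln (cos x)); last by field.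
by rewrite expRN lnK.
Qed.

Lemma cosE_cbrtV x : 0 < cos x -> cos x = g x ^- 3.
Proof. by move=> /cos_cbrtV3 ->; rewrite invrK. Qed.

Lemma is_derive_profile x : 0 < cos x -> is_derive x 1 profile (profile' x).
Proof.
move=> c0.
have dl : is_derive x 1 (fun y => ln (cos y)) ((cos x)^-1 * - sin x).
  have := @is_derive1_comp R (@ln R) cos x _ _ (is_derive1_ln c0) (is_derive_cos x).
  by rewrite /comp mulrC.
have dg : is_derive x 1 g (g x * (- ((cos x)^-1 * - sin x) / 3)).
  have dm : is_derive x 1 (fun y => - (ln (cos y)) / 3) (- ((cos x)^-1 * - sin x) / 3).
    apply: is_derive_eq; rewrite /GRing.scale /=; lra.
  have := @is_derive1_comp R expR _ x _ _ (is_derive_expR _) dm.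
  by rewrite /comp mulrC.
apply: is_derive_eq; rewrite /GRing.scale /= /profile'.
rewrite (exprSr (g x) 3) cos_cbrtV3//; field; exact: lt0r_neq0.
Qed.

Lemma cos_cbrtV_ge1 x : 0 < cos x -> 1 <= g x.
Proof.
move=> c0; rewrite -(@expr_ge1 _ 3)//; last exact/ltW/cos_cbrtV_gt0.
by rewrite cos_cbrtV3// invf_ge1// cos_le1.
Qed.

Lemma cos_pos x : 0 <= x < pi / 2 -> 0 < cos x.
Proof.
move=> /andP[x0 x1]; apply: cos_gt0_pihalf; rewrite x1 andbT.
by apply: lt_le_trans x0; have := @pi_gt0 R; lra.
Qed.

Lemma half_step_range n : (1 < n)%N -> 0 < (pi / (2 * n%:R) : R) < pi / 2.
Proof.
move=> n1; have n0 : 0 < n%:R :> R by rewrite ltr0n ltnW.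
rewrite divr_gt0 ?pi_gt0 ?mulr_gt0//= ltr_pM2l ?pi_gt0//.
by rewrite ltf_pV2 ?posrE ?mulr_gt0// ltr_pMr// ltr1n.
Qed.

Lemma cos_half_step_gt0 n : (1 < n)%N -> 0 < cos (pi / (2 * n%:R) : R).
Proof. by move=> /half_step_range/andP[/ltW x0 x1]; apply: cos_pos; rewrite x0. Qed.

Lemma tan_half_step_gt0 n : (1 < n)%N -> 0 < tan (pi / (2 * n%:R) : R).
Proof.
by move=> n1; rewrite divr_gt0 ?cos_half_step_gt0// sin_gt0_pihalf// half_step_range.
Qed.

(** In terms of g = cos^(-1/3) the derivative is increasing because
    g |-> 2 g^-2 + g^4 increases for g >= 1. *)
Lemma profile'E x : 0 < cos x -> profile' x = (2 * (g x)^- 2 + g x ^+ 4) / 3.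
Proof.
move=> c0; rewrite /profile' sin2cos2 cosE_cbrtV//.
by have g0 := cos_cbrtV_gt0 x; field; exact: lt0r_neq0.
Qed.

Lemma profile'_lt x y : 0 <= x -> x < y -> y < pi / 2 -> profile' x < profile' y.
Proof.
move=> x0 xy y1.
have cx : 0 < cos x by apply: cos_pos; rewrite x0 (lt_trans xy).
have cy : 0 < cos y by apply: cos_pos; rewrite y1 andbT (le_trans x0)// ltW.
have cyx : cos y < cos x.
  have pi0 := @pi_gt0 R.
  by rewrite ltr_cos// in_itv/=; apply/andP; split; lra.
have gxy : g x < g y.
  rewrite -(@ltr_pXn2r _ 3)// ?nnegrE ?ltW ?cos_cbrtV_gt0//.
  by rewrite !cos_cbrtV3// ltf_pV2.
have gx := cos_cbrtV_ge1 cx.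
rewrite !profile'E// ltr_pM2r ?invr_gt0//.
move: (g x) (g y) gx gxy => u v u1 uv.
have u0 : 0 < u by lra.
have v0 : 0 < v by lra.
rewrite -subr_gt0.
have -> : 2 * v^-2 + v ^+ 4 - (2 * u^-2 + u ^+ 4) =
   (v - u) * (v + u) * ((v ^+ 2 + u ^+ 2) - 2 * ((u * v) ^- 2)).
  by field; rewrite !lt0r_neq0.
have u2 : 1 <= u ^+ 2 by rewrite expr_ge1// ltW.
have v2 : 1 < v ^+ 2 by rewrite expr_gt1//; lra.
have uv1 : (u * v) ^- 2 <= 1.
  by rewrite invf_le1 ?exprn_gt0 ?mulr_gt0// exprMn; nra.
by rewrite mulr_gt0 ?mulr_gt0//; lra.
Qed.

(** Strict convexity, as the mean value theorem yields it from [profile'_lt]. *)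
Lemma profile_tangent x y : 0 <= x < pi / 2 -> 0 <= y < pi / 2 -> x != y ->
  profile x + profile' x * (y - x) < profile y.
Proof.
move=> /andP[x0 x1] /andP[y0 y1].
have dp z : 0 <= z -> z < pi / 2 -> is_derive z 1 profile (profile' z).
  by move=> z0 z1; apply: is_derive_profile; apply: cos_pos; rewrite z0.
have cp a b : 0 <= a -> b < pi / 2 -> {within `[a, b], continuous profile}.
  move=> a0 b1; apply: derivable_within_continuous => z; rewrite in_itv/= => /andP[az zb].
  have [] := dp z _ _ => //; lra.
rewrite neq_lt => /orP[xy|yx].
  have [|z /[!in_itv]/= /andP[xz zy] e] := @MVT R profile profile' x y xy _ (cp _ _ x0 y1).
    by move=> z; rewrite in_itv/= => /andP[? ?]; apply: dp; lra.
  have := profile'_lt x0 xz (lt_trans zy y1).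
  rewrite -(@ltr_pM2r _ (y - x)) ?subr_gt0// -e; lra.
have [|z /[!in_itv]/= /andP[yz zx] e] := @MVT R profile profile' y x yx _ (cp _ _ y0 x1).
  by move=> z; rewrite in_itv/= => /andP[? ?]; apply: dp; lra.
have := profile'_lt (le_trans y0 (ltW yz)) zx x1.
rewrite -(@ltr_pM2r _ (x - y)) ?subr_gt0// -e; lra.
Qed.

(** The right-hand side is the area of a pair of opposite triangles of opening
    2x.  By h h' <= ((h + h')/2)^2 it is at least a^3 / I^2, with
    a = 2 profile x and I = (h + h') tan x, and a^3 / I^2 >= 3 t^2 a - 2 t^3 I
    is the inequality of the means, with equality at t = a / I. *)
Lemma sector_bound x (h h' t : R) : 0 <= x < pi / 2 -> 0 < h -> 0 < h' -> 0 < t ->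
  6 * t ^+ 2 * profile x - 2 * t ^+ 3 * ((h + h') * tan x)
  <= sin (2 * x) / (h * h').
Proof.
move=> xr h0 h'0 t0; have c0 := cos_pos xr.
have s0 : 0 <= sin x.
  apply: sin_ge0_pi; case/andP: xr => -> x1 /=; have := @pi_gt0 R; lra.
rewrite (mulr_natl x 2) sin_mulr2n /tan /profile cosE_cbrtV//.
have g0 := cos_cbrtV_gt0 x; move: (g x) g0 (sin x) s0 => u u0 s s0.
pose m := (h + h') / 2.
have m0 : 0 < m by rewrite /m; lra.
have hm : h * h' <= m ^+ 2 by rewrite /m; have := sqr_ge0 (h - h'); nra.
have le1 : (u ^- 3 * s *+ 2) / m ^+ 2 <= (u ^- 3 * s *+ 2) / (h * h').
  rewrite ler_wpM2l ?lef_pV2 ?posrE ?mulr_gt0 ?exprn_gt0 ?addr_gt0//.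
  by rewrite mulrn_wge0// mulr_ge0// invr_ge0 exprn_ge0// ltW.
apply: le_trans le1.
(* y is the ratio of t to a / I, so that equality holds at y = 1. *)
pose y := t * m * u ^+ 2.
rewrite -subr_ge0.
have -> : u ^- 3 * s *+ 2 / m ^+ 2 -
    (6 * t ^+ 2 * (s * u) - 2 * t ^+ 3 * ((h + h') * (s / u ^- 3))) =
    2 * s * ((1 - y) ^+ 2 * (1 + 2 * y)) / (m ^+ 2 * u ^+ 3).
  have -> : h + h' = 2 * m by rewrite /m; lra.
  by rewrite /y -mulr_natl; field; rewrite !lt0r_neq0.
have y0 : 0 < y by rewrite !mulr_gt0 ?exprn_gt0 ?addr_gt0//.
apply: divr_ge0; last by rewrite mulr_ge0 ?exprn_ge0 ?ltW.
by apply: mulr_ge0; [rewrite mulr_ge0|rewrite mulr_ge0 ?sqr_ge0]; lra.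
Qed.

(** The sector bounds are summed with one common slope t, the value of a / I for
    n equal sectors when S^2 = 2n; the convexity of the profile then bounds the
    sum of the a_j, given the sum of the angles. *)
Lemma fan_inequality n (x h : nat -> R) (S : R) (x0 := pi / (2 * n%:R)) :
  (1 < n)%N ->
  (forall j, (j < n)%N -> 0 <= x j < pi / 2) ->
  (forall j, 0 < h j) ->
  \sum_(0 <= j < n) x j = pi / 2 ->
  \sum_(0 <= j < n) (h j + h j.+1) * tan (x j) = 2 * S ->
  0 <= S -> S ^+ 2 <= 2 * n%:R ->
  n%:R ^+ 2 * profile x0 ^+ 3 <= \sum_(0 <= j < n) sin (2 * x j) / (h j * h j.+1)
  /\ (\sum_(0 <= j < n) sin (2 * x j) / (h j * h j.+1) <= n%:R ^+ 2 * profile x0 ^+ 3 ->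
      (forall j, (j < n)%N -> x j = x0) /\ S ^+ 2 = 2 * n%:R).
Proof.
move=> n1 xr h0 sx sI S0 S2.
have nn : 0 < n%:R :> R by rewrite ltr0n ltnW.
have /andP[x00 x01] := half_step_range n1.
have x0r : 0 <= x0 < pi / 2 by rewrite ltW.
have P0 : 0 < profile x0.
  by rewrite mulr_gt0 ?cos_cbrtV_gt0// sin_gt0_pihalf// x00.
(* The bound S^2 <= 2n reads S <= 2q. *)
pose q := Num.sqrt (n%:R / 2 : R).
have q0 : 0 < q by rewrite sqrtr_gt0; lra.
have q2 : q ^+ 2 = n%:R / 2 by rewrite sqr_sqrtr//; lra.
pose t := profile x0 * q.
have t0 : 0 < t by rewrite mulr_gt0.
have Sq : S <= 2 * q.
  by rewrite -(@ler_pXn2r _ 2)// ?nnegrE ?exprMn ?q2 //; lra.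
have lb : 6 * t ^+ 2 * (\sum_(0 <= j < n) profile (x j)) - 2 * t ^+ 3 * (2 * S) <=
    \sum_(0 <= j < n) sin (2 * x j) / (h j * h j.+1).
  rewrite -sI !mulr_sumr -sumrB; apply: ler_sum_nat => j /andP[_ jn].
  exact: sector_bound (xr j jn) (h0 _) (h0 _) t0.
have tl j : (j < n)%N -> profile x0 + profile' x0 * (x j - x0) <= profile (x j).
  move=> jn; have [->|xj] := eqVneq (x j) x0; first by rewrite subrr mulr0 addr0.
  by apply/ltW/profile_tangent; rewrite ?xr// eq_sym.
have st : \sum_(0 <= j < n) (profile x0 + profile' x0 * (x j - x0)) = n%:R * profile x0.
  rewrite big_split /= sumr_const_nat subn0 -mulr_sumr sumrB sx sumr_const_nat subn0.
  rewrite -(mulr_natl (profile x0)) -(mulr_natl x0) {3}/x0; field; exact: lt0r_neq0.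
have sp : n%:R * profile x0 <= \sum_(0 <= j < n) profile (x j).
  by rewrite -st; apply: ler_sum_nat => j /andP[_]; exact: tl.
have t2 : t ^+ 2 = profile x0 ^+ 2 * (n%:R / 2) by rewrite exprMn q2.
have E : n%:R ^+ 2 * profile x0 ^+ 3 = 6 * t ^+ 2 * (n%:R * profile x0) - 2 * t ^+ 3 * (4 * q).
  rewrite (exprSr t 2) t2 /t.
  have -> : 2 * (profile x0 ^+ 2 * (n%:R / 2) * (profile x0 * q)) * (4 * q) =
    4 * profile x0 ^+ 3 * n%:R * q ^+ 2 by field.
  by rewrite q2; field.
have k1 : 0 < 6 * t ^+ 2 by rewrite mulr_gt0// exprn_gt0.
have k2 : 0 < 2 * t ^+ 3 by rewrite mulr_gt0// exprn_gt0.
have m1 : 6 * t ^+ 2 * (n%:R * profile x0) <= 6 * t ^+ 2 * \sum_(0 <= j < n) profile (x j).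
  by rewrite ler_pM2l.
have m2 : 2 * t ^+ 3 * (2 * S) <= 2 * t ^+ 3 * (4 * q).
  by rewrite ler_pM2l//; lra.
split; first by apply: le_trans lb; rewrite E; lra.
rewrite E => ub; split => [j jn|].
  apply/eqP; apply: contraT => xj.
  have : n%:R * profile x0 < \sum_(0 <= j < n) profile (x j).
    rewrite -st !big_mkord (bigD1 (Ordinal jn))//= [ltRHS](bigD1 (Ordinal jn))//=.
    apply: ltr_leD; last by apply: ler_sum => i _; exact: tl.
    by apply: profile_tangent; rewrite ?xr// eq_sym.
  rewrite -(ltr_pM2l k1); lra.
have -> : S = 2 * q.
  apply/eqP; rewrite eq_le Sq /= -subr_le0 -(pmulr_rle0 _ k2); lra.
rewrite exprMn q2; lra.
Qed.

End Profile.

(** * Polygonal norms and their fans *)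

Section Fan.
Variable R : realType.
Variables (n : nat) (f r : nat -> R).

Definition cross (p q : R * R) : R := p.1 * q.2 - p.2 * q.1.
Definition ray (t : R) : R * R := (cos t, sin t).
Definition comb (s t : R) (p q : R * R) : R * R :=
  (s * p.1 + t * q.1, s * p.2 + t * q.2).

(** Every sum of absolute values of linear forms has this shape: the form
    r_i det(e(f_i), .) vanishes along e(f_i), which is a vertex direction of the
    unit ball. *)
Definition zonorm (p : R * R) : R := \sum_(0 <= i < n) r i * `|cross (ray (f i)) p|.

(** The value of the norm at a unit vector: its inverse is the distance from the
    origin to the j-th vertex of the unit ball. *)
Definition height j := zonorm (ray (f j)).

Lemma cross_ray a b : cross (ray a) (ray b) = sin (b - a).
Proof. by rewrite /cross /= sinB; ring. Qed.

Lemma cross_comb p s t q q' : cross p (comb s t q q') = s * cross p q + t * cross p q'.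
Proof. by rewrite /cross /=; ring. Qed.

Lemma crossN p q : cross p (- q) = - cross p q.
Proof. by rewrite /cross /=; ring. Qed.

Lemma zonormN p : zonorm (- p) = zonorm p.
Proof. by apply: eq_bigr => i _; rewrite crossN normrN. Qed.

Hypothesis r_ge0 : forall i, 0 <= r i.

Hypothesis f_sorted : forall i j, (i <= j <= n)%N -> f i <= f j.
Hypothesis f_half_turn : f n = f 0%N + pi.

Lemma fan_gap i j : (i <= j <= n)%N -> 0 <= f j - f i <= pi.
Proof.
move=> /andP[ij jn]; rewrite subr_ge0 f_sorted ?ij//=.
have := @f_sorted 0 i; have := @f_sorted j n; rewrite jn leqnn (leq_trans ij jn) => /(_ isT) + /(_ isT).
rewrite f_half_turn; lra.
Qed.

Lemma sin_fan_ge0 i j : (i <= j <= n)%N -> 0 <= sin (f j - f i).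
Proof. by move=> /fan_gap/sin_ge0_pi. Qed.

Lemma cross_fan_norm i j : (i < n)%N -> (j <= n)%N ->
  `|cross (ray (f i)) (ray (f j))| =
  if (i <= j)%N then sin (f j - f i) else - sin (f j - f i).
Proof.
move=> lin ljn; rewrite cross_ray; case: ifPn => [ij|].
  by rewrite ger0_norm// sin_fan_ge0// ij.
rewrite -ltnNge => ji; rewrite ler0_norm// -opprB sinN oppr_le0.
by rewrite sin_fan_ge0// (ltnW ji) ltnW.
Qed.

(** None of the forms changes sign between two consecutive directions. *)
Lemma zonorm_cone j s t : (j < n)%N -> 0 <= s -> 0 <= t ->
  zonorm (comb s t (ray (f j)) (ray (f j.+1))) = s * height j + t * height j.+1.
Proof.
move=> jn s0 t0; rewrite /height !mulr_sumr -big_split /=; apply: eq_big_nat => i /andP[_ lin].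
rewrite cross_comb !(mulrCA _ (r i)) -mulrDr; congr (_ * _).
rewrite !cross_fan_norm ?(ltnW jn)//.
have [ij|ji] := leqP i j.
  rewrite !cross_ray (leqW ij) ger0_norm// addr_ge0// mulr_ge0//; apply: sin_fan_ge0.
    by rewrite ij ltnW.
  by rewrite jn (leqW ij).
have [ij'|] := leqP i j.+1.
  have -> : i = j.+1 by apply/eqP; rewrite eqn_leq ij' ji.
  rewrite !cross_ray subrr sin0 !mulr0 !addr0 normrM ger0_norm// ler0_norm//.
  by rewrite -opprB sinN oppr_le0 sin_fan_ge0// leqnSn.
move=> ij'; rewrite !cross_ray ler0_norm ?opprD ?mulrN//.
rewrite -!(opprB (f i)) !sinN !mulrN -opprD oppr_le0 addr_ge0// mulr_ge0//; apply: sin_fan_ge0.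
  by rewrite (ltnW ji) ltnW.
by rewrite (ltnW ij') ltnW.
Qed.

(** The integral of sine over [a, b], written as the trapezoidal sum of its end
    values with the weight tan((b - a)/2). *)
Lemma sum_sin_tan (a b : R) : cos ((b - a) / 2) != 0 ->
  (sin a + sin b) * tan ((b - a) / 2) = cos a - cos b.
Proof.
move=> c0; pose u := (a + b) / 2; pose v := (b - a) / 2.
have ea : a = u - v by rewrite /u /v; lra.
have eb : b = u + v by rewrite /u /v; lra.
rewrite -/v in c0 *; clearbody u v; subst a b.
by rewrite sinB sinD cosB cosD /tan; field.
Qed.

(** Each summand is the integral over a sector of t |-> N(e(t)), and each
    |sin(t - f_i)| has integral 2 over a half turn.  Exchanging the two sums, the
    contributions of a fixed i telescope on both sides of f_i, where the sine
    changes sign. *)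
Lemma sum_heights_tan :
  (forall j, (j < n)%N -> cos ((f j.+1 - f j) / 2) != 0) ->
  \sum_(0 <= j < n) (height j + height j.+1) * tan ((f j.+1 - f j) / 2) =
  2 * \sum_(0 <= i < n) r i.
Proof.
move=> c0.
transitivity (\sum_(0 <= j < n) \sum_(0 <= i < n) r i *
   ((`|cross (ray (f i)) (ray (f j))| + `|cross (ray (f i)) (ray (f j.+1))|) *
     tan ((f j.+1 - f j) / 2))).
  apply: eq_bigr => j _; rewrite /height -big_split mulr_suml; apply: eq_bigr => i _ /=.
  by rewrite [in RHS]mulrA mulrDr.
rewrite exchange_big mulr_sumr /=; apply: eq_big_nat => i /andP[_ lin].
rewrite -mulr_sumr mulrC; congr (_ * _).
rewrite (@big_cat_nat _ _ _ i)//=; last exact: ltnW.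
have -> : \sum_(0 <= j < i) (`|cross (ray (f i)) (ray (f j))| +
    `|cross (ray (f i)) (ray (f j.+1))|) * tan ((f j.+1 - f j) / 2) =
    \sum_(0 <= j < i) (cos (f j.+1 - f i) - cos (f j - f i)).
  apply: eq_big_nat => j /andP[_ ji]; have jn := ltn_trans ji lin.
  rewrite !cross_fan_norm// ?(ltnW jn)// leqNgt ji /=.
  have -> : (if (i <= j.+1)%N then sin (f j.+1 - f i) else - sin (f j.+1 - f i)) = - sin (f j.+1 - f i).
    case: ifPn => // ij; have -> : i = j.+1 by apply/eqP; rewrite eqn_leq ij.
    by rewrite subrr sin0 oppr0.
  have e : f j.+1 - f j = (f j.+1 - f i) - (f j - f i) by lra.
  by rewrite -opprD mulNr e sum_sin_tan -?e ?c0// opprB.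
have -> : \sum_(i <= j < n) (`|cross (ray (f i)) (ray (f j))| +
    `|cross (ray (f i)) (ray (f j.+1))|) * tan ((f j.+1 - f j) / 2) =
    - \sum_(i <= j < n) (cos (f j.+1 - f i) - cos (f j - f i)).
  rewrite -sumrN; apply: eq_big_nat => j /andP[ij jn].
  rewrite !cross_fan_norm// ?(ltnW jn)// ij leqW//.
  have e : f j.+1 - f j = (f j.+1 - f i) - (f j - f i) by lra.
  by rewrite e sum_sin_tan -?e ?c0// opprB.
rewrite !telescope_sumr ?(ltnW lin)// subrr cos0 f_half_turn.
have -> : f 0%N + pi - f i = (f 0%N - f i) + pi by lra.
rewrite cosDpi; lra.
Qed.

Hypothesis zonorm_gt0 : forall p, p != 0 -> 0 < zonorm p.

Lemma height_gt0 j : 0 < height j.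
Proof.
apply: zonorm_gt0; apply/eqP => -[c0 s0].
by have := cos2Dsin2 (f j); rewrite c0 s0 expr0n/= addr0 => /eqP; rewrite eq_sym oner_eq0.
Qed.

(** A gap of pi would make N linear on a closed half-plane, hence zero on the
    line that bounds it. *)
Lemma fan_gap_lt_pi j : (j < n)%N -> 0 <= f j.+1 - f j < pi.
Proof.
move=> jn; have := @fan_gap j j.+1; rewrite leqnSn jn => /(_ isT)/andP[-> le] /=.
rewrite lt_neqAle le andbT; apply/eqP => e.
have := @zonorm_cone j 1 1 jn ler01 ler01.
have -> : comb 1 1 (ray (f j)) (ray (f j.+1)) = 0.
  have -> : f j.+1 = f j + pi by lra.
  by rewrite /comb /= cosDpi sinDpi !mul1r !subrr.
have -> : zonorm 0 = 0.
  by apply: big1 => i _; rewrite /cross /= !mulr0 subrr normr0 mulr0.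
have := height_gt0 j; have := height_gt0 j.+1; lra.
Qed.

Lemma half_gap_range j : (j < n)%N -> 0 <= (f j.+1 - f j) / 2 < pi / 2.
Proof. move=> /fan_gap_lt_pi/andP[? ?]; apply/andP; split; lra. Qed.

Local Notation mR := (measurableTypeR R).
Local Notation mu2 := (@product_measure1 _ _ mR mR R
  (@lebesgue_measure R) (@lebesgue_measure R)).

Definition in_cone j (p : R * R) := exists s t, [/\ 0 < s, 0 < t,
  s * height j + t * height j.+1 < 1 & p = comb s t (ray (f j)) (ray (f j.+1))].

Lemma in_cone_zonorm j p : (j < n)%N -> in_cone j p -> zonorm p <= 1.
Proof. by move=> jn [s [t [s0 t0 st ->]]]; rewrite zonorm_cone ?ltW. Qed.

Lemma in_cone_cross_ge0 i j p : (i <= j < n)%N -> in_cone j p -> 0 <= cross (ray (f i)) p.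
Proof.
move=> /andP[ij jn] [s [t [s0 t0 _ ->]]]; rewrite cross_comb !cross_ray.
rewrite addr_ge0 ?mulr_ge0 ?(ltW s0) ?(ltW t0)//; apply: sin_fan_ge0.
  by rewrite ij ltnW.
by rewrite jn leqW.
Qed.

Lemma in_cone_cross_gt0 j p : 0 < sin (f j.+1 - f j) -> in_cone j p -> 0 < cross (ray (f j)) p.
Proof.
move=> s0j [s [t [s0 t0 _ ->]]].
by rewrite cross_comb !cross_ray subrr sin0 mulr0 add0r mulr_gt0.
Qed.

Lemma in_cone_cross_lt0 j p : 0 < sin (f j.+1 - f j) -> in_cone j p -> cross (ray (f j.+1)) p < 0.
Proof.
move=> s0j [s [t [s0 t0 _ ->]]].
by rewrite cross_comb !cross_ray subrr sin0 mulr0 addr0 -opprB sinN mulrN oppr_lt0 mulr_gt0.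
Qed.

(** The line through e(f_(j+1)) separates the j-th sector from the later ones,
    and the line through e(f_j) separates it from their opposites. *)
Lemma in_cone_disjoint j k p : (j < k < n)%N -> 0 < sin (f j.+1 - f j) ->
  in_cone j p -> in_cone k p -> False.
Proof.
move=> jkn s0 /(in_cone_cross_lt0 s0) + /(in_cone_cross_ge0 jkn).
by move=> /lt_le_trans/[apply]; rewrite ltxx.
Qed.

Lemma in_cone_disjointN j k p : (j <= k < n)%N -> 0 < sin (f j.+1 - f j) ->
  in_cone j p -> in_cone k (- p) -> False.
Proof.
move=> jkn s0 /(in_cone_cross_gt0 s0) + /(in_cone_cross_ge0 jkn).
by rewrite crossN; lra.
Qed.

Definition double_cone j : set (mR * mR) := [set p | in_cone j p \/ in_cone j (- (p : R * R))].

Lemma double_cone_disjoint j k p : (j < k < n)%N -> 0 < sin (f j.+1 - f j) ->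
  double_cone j p -> double_cone k p -> False.
Proof.
move=> jkn s0; have jkn' : (j <= k < n)%N by case/andP: jkn => /ltnW ->.
case=> [pj|pj] [pk|pk].
- exact: in_cone_disjoint jkn s0 pj pk.
- exact: in_cone_disjointN jkn' s0 pj pk.
- by apply: in_cone_disjointN jkn' s0 pj _; rewrite opprK.
- exact: in_cone_disjoint jkn s0 pj pk.
Qed.

Lemma in_coneE j : [set p : mR * mR | in_cone j p] =
  (fun p : mR * mR =>
     (cos (f j) / height j * p.1 + cos (f j.+1) / height j.+1 * p.2,
      sin (f j) / height j * p.1 + sin (f j.+1) / height j.+1 * p.2) : mR * mR)
  @` open_triangle (R := R).
Proof.
have h1 := height_gt0 j; have h2 := height_gt0 j.+1.
apply/seteqP; split => [_ [s [t [s0 t0 st ->]]]|_ [[s t] [/= s0 t0 st] <-]].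
  exists (s * height j, t * height j.+1).
    by split => //=; rewrite mulr_gt0.
  by rewrite /comb /=; congr (_, _); field; rewrite !lt0r_neq0.
exists (s / height j), (t / height j.+1); split; rewrite ?divr_gt0//.
  by rewrite !divfK ?lt0r_neq0.
by rewrite /comb /=; congr (_, _); field; rewrite !lt0r_neq0.
Qed.

Lemma in_coneNE j : [set p : mR * mR | in_cone j (- (p : R * R))] =
  (fun p : mR * mR =>
     (- (cos (f j) / height j) * p.1 + - (cos (f j.+1) / height j.+1) * p.2,
      - (sin (f j) / height j) * p.1 + - (sin (f j.+1) / height j.+1) * p.2) : mR * mR)
  @` open_triangle (R := R).
Proof.
have := in_coneE j => /seteqP[sub1 sub2].
apply/seteqP; split => [p /sub1 [q Tq [e1 e2]]|_ [q Tq <-]].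
  exists q => //; rewrite !mulNr -!opprD [X in (- X, _)]e1 [X in (_, - X)]e2.
  by case: p {e1 e2} => x y; congr (_, _); exact: opprK.
by apply: sub2; exists q => //; congr (_, _); rewrite /= -[LHS](opprK (_ : R)) opprD -!mulNr.
Qed.

Lemma cone_det j :
  cos (f j) / height j * (sin (f j.+1) / height j.+1) -
  cos (f j.+1) / height j.+1 * (sin (f j) / height j) =
  sin (f j.+1 - f j) / (height j * height j.+1).
Proof.
have h1 := height_gt0 j; have h2 := height_gt0 j.+1.
by rewrite sinB; field; rewrite !lt0r_neq0.
Qed.

Lemma measurable_double_cone j : 0 < sin (f j.+1 - f j) -> measurable (double_cone j).
Proof.
move=> s0; have := cone_det j.
have d0 : 0 < sin (f j.+1 - f j) / (height j * height j.+1).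
  by rewrite divr_gt0// mulr_gt0// height_gt0.
move=> dE; apply: (@measurableU _ _ [set p | in_cone j p] [set p | in_cone j (- (p : R * R))]).
  rewrite in_coneE; apply: measurable_image_linear; last exact: measurable_open_triangle.
  by rewrite dE lt0r_neq0.
rewrite in_coneNE; apply: measurable_image_linear; last exact: measurable_open_triangle.
by rewrite !mulrNN dE lt0r_neq0.
Qed.

Lemma mu2_double_cone j : (j < n)%N -> 0 < sin (f j.+1 - f j) ->
  mu2 (double_cone j) = (sin (f j.+1 - f j) / (height j * height j.+1))%:E.
Proof.
move=> jn s0; have dE := cone_det j.
have d0 : 0 < sin (f j.+1 - f j) / (height j * height j.+1).
  by rewrite divr_gt0// mulr_gt0// height_gt0.
pose C1 : set (mR * mR) := [set p | in_cone j p].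
pose C2 : set (mR * mR) := [set p | in_cone j (- (p : R * R))].
have mC1 : measurable C1.
  rewrite /C1 in_coneE; apply: measurable_image_linear; last exact: measurable_open_triangle.
  by rewrite dE lt0r_neq0.
have mC2 : measurable C2.
  rewrite /C2 in_coneNE; apply: measurable_image_linear; last exact: measurable_open_triangle.
  by rewrite !mulrNN dE lt0r_neq0.
transitivity (mu2 C1 + mu2 C2)%E.
  apply: measureU => //.
  apply/seteqP; split => // p [p1 p2]; apply: in_cone_disjointN p1 p2 => //.
  by rewrite leqnn.
rewrite /C1 /C2 in_coneE in_coneNE !mu2_image_linear ?mulrNN ?dE ?lt0r_neq0//;
  try exact: measurable_open_triangle.
rewrite [X in (_ * X)%E]mu2_open_triangle gtr0_norm//.
by rewrite -EFinM -EFinD; congr EFin; lra.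
Qed.

(** The double triangles of positive opening are disjoint and lie in the ball. *)
Lemma fan_area_ge (B : set (mR * mR)) : measurable B ->
  (forall p, zonorm p <= 1 -> B p) ->
  ((\sum_(0 <= j < n) sin (f j.+1 - f j) / (height j * height j.+1))%:E <= mu2 B)%E.
Proof.
move=> mB NB.
pose P (j : 'I_n) := 0 < sin (f j.+1 - f j).
have -> : \sum_(0 <= j < n) sin (f j.+1 - f j) / (height j * height j.+1) =
  \sum_(j < n | P j) sin (f j.+1 - f j) / (height j * height j.+1).
  rewrite big_mkord big_mkcond [RHS]big_mkcond /=; apply: eq_bigr => j _.
  rewrite /P; case: ifPn => //; rewrite -leNgt => s0.
  have /eqP -> : sin (f j.+1 - f j) == 0 by rewrite eq_le s0 sin_fan_ge0// leqnSn ltn_ord.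
  by rewrite mul0r.
rewrite -sumEFin; under eq_bigr do rewrite -mu2_double_cone//.
rewrite -measure_bigsetU_ord_cond.
- apply: le_measure.
  + rewrite inE; apply: bigsetU_measurable => j Pj; exact: measurable_double_cone.
  + by rewrite inE.
  + apply: (big_ind (fun A => A `<=` B)) => [//|A1 A2 AB1 AB2|j Pj p].
      by rewrite subUset.
    by case=> /(in_cone_zonorm (ltn_ord j)); rewrite ?zonormN; exact: NB.
- by move=> j Pj; exact: measurable_double_cone.
- move=> i j Pi Pj [p [pi pj]]; apply: val_inj => /=.
  have [ij|ji|//] := ltngtP i j.
    by have := @double_cone_disjoint i j p; rewrite ij ltn_ord => /(_ isT Pi pi pj).
  by have := @double_cone_disjoint j i p; rewrite ji ltn_ord => /(_ isT Pj pj pi).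
Qed.

Lemma sum_sqr_dev (m : R) : \sum_(0 <= i < n) (r i - m) ^+ 2 =
  \sum_(0 <= i < n) r i ^+ 2 - 2 * m * \sum_(0 <= i < n) r i + n%:R * m ^+ 2.
Proof.
transitivity (\sum_(0 <= i < n) (r i ^+ 2 - 2 * m * r i + m ^+ 2)).
  by apply: eq_bigr => i _; ring.
by rewrite big_split sumrB -mulr_sumr sumr_const_nat subn0 -(mulr_natl (m ^+ 2)).
Qed.

(** Here S is the sum of the r_i.  The variance of the r_i is nonnegative, which
    gives S^2 <= 2n, and vanishes when S^2 = 2n. *)
Lemma fan_min_area (B : set (mR * mR)) : (1 < n)%N -> measurable B ->
  (forall p, zonorm p <= 1 -> B p) ->
  \sum_(0 <= i < n) r i ^+ 2 = 2 ->
  ((min_volume R n)%:E <= mu2 B)%E /\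
  (mu2 B = (min_volume R n)%:E ->
    (forall j, (j < n)%N -> f j.+1 - f j = pi / n%:R) /\
    (forall j, (j < n)%N -> r j = Num.sqrt (2 / n%:R))).
Proof.
move=> n1 mB NB r2.
pose S := \sum_(0 <= i < n) r i.
have nn : 0 < n%:R :> R by rewrite ltr0n ltnW.
have S0 : 0 <= S by apply: sumr_ge0.
have dev := sum_sqr_dev (S / n%:R); rewrite r2 -/S in dev.
have devE : \sum_(0 <= i < n) (r i - S / n%:R) ^+ 2 = 2 - S ^+ 2 / n%:R.
  by rewrite dev; field; rewrite lt0r_neq0.
have S2 : S ^+ 2 <= 2 * n%:R.
  by rewrite -ler_pdivrMr// -subr_ge0 -devE; apply: sumr_ge0 => i _; exact: sqr_ge0.
have area := fan_area_ge mB NB.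
have xr j : (j < n)%N -> 0 <= (f j.+1 - f j) / 2 < pi / 2 by exact: half_gap_range.
have sx : \sum_(0 <= j < n) (f j.+1 - f j) / 2 = pi / 2.
  by rewrite -mulr_suml telescope_sumr// f_half_turn; congr (_ / _); lra.
have sI : \sum_(0 <= j < n) (height j + height j.+1) * tan ((f j.+1 - f j) / 2) = 2 * S.
  by apply: sum_heights_tan => j jn; rewrite lt0r_neq0// cos_pos ?xr.
have [ge eq] := fan_inequality n1 xr height_gt0 sx sI S0 S2.
have sE : \sum_(0 <= j < n) sin (2 * ((f j.+1 - f j) / 2)) / (height j * height j.+1) =
   \sum_(0 <= j < n) sin (f j.+1 - f j) / (height j * height j.+1).
  by apply: eq_bigr => j _; congr (sin _ / _); field.
have mE : min_volume R n = n%:R ^+ 2 * profile (pi / (2 * n%:R) : R) ^+ 3.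
  by rewrite /min_volume /profile exprMn cos_cbrtV3 ?mulrA// cos_half_step_gt0.
rewrite sE -mE in ge eq.
split; first by apply: le_trans area; rewrite lee_fin.
move=> Bmin; rewrite Bmin lee_fin in area.
have {}[ex eS] := eq area.
split => [j jn|j jn].
  have := ex j jn => e; rewrite -[LHS](@divfK _ 2)// e; field; exact: lt0r_neq0.
have := devE; rewrite eS mulfK ?lt0r_neq0// subrr => /eqP.
rewrite big_mkord psumr_eq0; last by move=> i _; exact: sqr_ge0.
move=> /allP/(_ (Ordinal jn) (mem_index_enum _)) /=; rewrite sqrf_eq0 subr_eq0 => /eqP ->.
apply/eqP; rewrite -(@eqrXn2 _ 2)// ?sqrtr_ge0 ?divr_ge0// ?ltW// sqr_sqrtr ?divr_ge0 ?ltW//.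
by rewrite expr_div_n eS; apply/eqP; field; rewrite lt0r_neq0.
Qed.

End Fan.

(** * Equally spaced directions *)

Section Equispaced.
Variable R : realType.
Variables (n : nat) (f0 c : R).
Hypotheses (n_gt1 : (1 < n)%N) (c_gt0 : 0 < c).

Local Notation mR := (measurableTypeR R).
Local Notation mu2 := (@product_measure1 _ _ mR mR R
  (@lebesgue_measure R) (@lebesgue_measure R)).

Let delta : R := pi / n%:R.
Definition equi (k : nat) : R := f0 + k%:R * (pi / n%:R).
Local Notation r := (fun _ : nat => c).
Local Notation N := (zonorm n equi r).
Local Notation ht := (height n equi r).
Let x0 : R := pi / (2 * n%:R).

Let nn : 0 < n%:R :> R. Proof. by rewrite ltr0n ltnW. Qed.

Let x0E : delta = 2 * x0.
Proof. by rewrite /delta /x0; field; rewrite lt0r_neq0. Qed.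

Let x0r : 0 < x0 < pi / 2. Proof. exact: half_step_range. Qed.

Let delta_gt0 : 0 < delta. Proof. by rewrite divr_gt0 ?pi_gt0. Qed.

Let sin_delta_gt0 : 0 < sin delta.
Proof. by apply: sin_gt0_pi; have /andP[? ?] := x0r; rewrite x0E; apply/andP; split; lra. Qed.

Lemma equiB i j : equi i - equi j = (i%:R - j%:R) * delta.
Proof. by rewrite /equi /delta; ring. Qed.

Lemma equiS j : equi j.+1 - equi j = delta.
Proof. by rewrite equiB -natr1; ring. Qed.

Lemma equi_half_turn : equi n = equi 0 + pi.
Proof. by rewrite /equi; field; rewrite lt0r_neq0. Qed.

Lemma equi_sorted i j : (i <= j <= n)%N -> equi i <= equi j.
Proof.
move=> /andP[ij _]; rewrite -subr_ge0 equiB mulr_ge0 ?subr_ge0 ?ler_nat//.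
exact: ltW.
Qed.

(** A rotation by pi/n permutes the lines spanned by the directions. *)
Lemma heightS j : ht j.+1 = ht j.
Proof.
rewrite /height /zonorm -!mulr_sumr; congr (_ * _).
pose G (i : nat) := `|cross (ray (equi i)) (ray (equi j.+1))|.
have E i : `|cross (ray (equi i)) (ray (equi j))| = G i.+1.
  by rewrite /G !cross_ray !equiB -!natr1; congr `|sin (_ * _)|; ring.
under [RHS]eq_bigr do rewrite E.
apply/eqP; rewrite eq_sym -subr_eq0 -sumrB telescope_sumr// subr_eq0.
rewrite /G !cross_ray equi_half_turn.
have -> : equi j.+1 - equi 0 = equi j.+1 - (equi 0 + pi) + pi by ring.
by rewrite sinDpi normrN.
Qed.

(** As all heights agree, [sum_heights_tan] leaves a single unknown. *)
Lemma heightE j : ht j = c / tan x0.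
Proof.
have cx : 0 < cos x0 by exact: cos_half_step_gt0.
have tx : 0 < tan x0 by exact: tan_half_step_gt0.
have -> : ht j = ht 0 by elim: j => // j; rewrite heightS.
have hd j' : (equi j'.+1 - equi j') / 2 = x0 by rewrite equiS x0E; field.
have := @sum_heights_tan R n equi r equi_sorted equi_half_turn.
have h0 j' : ht j' = ht 0 by elim: j' => // k; rewrite heightS.
under eq_bigr => j' do rewrite hd !h0 -?[X in X + _]h0.
rewrite !sumr_const_nat subn0 -(mulr_natl c) -(mulr_natl (_ * tan x0)) => H.
have {}H : n%:R * ((ht 0 + ht 0) * tan x0) = 2 * (n%:R * c).
  by apply: H => k _; rewrite hd lt0r_neq0.
apply: (mulIf (lt0r_neq0 tx)); rewrite divfK ?lt0r_neq0//.
apply: (mulfI (lt0r_neq0 nn)); lra.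
Qed.

Lemma sign_change (a : nat -> R) m : (0 < m)%N -> 0 <= a 0 -> a m <= 0 ->
  exists2 j, (j < m)%N & a j.+1 <= 0 <= a j.
Proof.
elim: m => // m IH _ a0 am.
have [am0|am0] := leP 0 (a m); first by exists m; rewrite ?am.
case: m IH am am0 => [|m] IH am am0; first by move: a0; rewrite leNgt am0.
by have [//|j jm aj] := IH _ a0 (ltW am0); exists j => //; exact: ltnW.
Qed.

(** Along the fan det(e(f_j), p) passes from its value at f_0 to the opposite
    value, so it changes sign between two consecutive directions, and the two
    determinants there are, up to sign and scale, the coordinates of p. *)
Lemma equi_cover (p : R * R) : exists j s t (b : bool), [/\ (j < n)%N, 0 <= s, 0 <= t &
  p = comb ((-1) ^+ b * s) ((-1) ^+ b * t) (ray (equi j)) (ray (equi j.+1))].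
Proof.
have cover_pos q : 0 <= cross (ray (equi 0)) q ->
    exists j s t, [/\ (j < n)%N, 0 <= s, 0 <= t & q = comb s t (ray (equi j)) (ray (equi j.+1))].
  move=> q0; have [||j jn /andP[aj1 aj]] := @sign_change (fun j => cross (ray (equi j)) q) n _ q0.
    exact: ltnW.
  rewrite equi_half_turn; move: q0; rewrite /cross /= cosDpi sinDpi; lra.
  exists j, (- cross (ray (equi j.+1)) q / sin delta), (cross (ray (equi j)) q / sin delta).
  split => //; first by rewrite divr_ge0 ?oppr_ge0// ltW.
    by rewrite divr_ge0// ltW.
  case: q {q0 aj1 aj} => x y; rewrite /comb /cross /= -(equiS j) sinB.
  have := sin_delta_gt0; rewrite -(equiS j) sinB => /lt0r_neq0 s0.
  by congr (_, _); field.
have [p0|p0] := leP 0 (cross (ray (equi 0)) p).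
  have [j [s [t [jn s0 t0 ->]]]] := cover_pos p p0.
  by exists j, s, t, false; rewrite !mul1r.
have [|j [s [t [jn s0 t0 e]]]] := cover_pos (- p).
  by rewrite crossN oppr_ge0 ltW.
exists j, s, t, true; split => //.
rewrite -[p]opprK e; case: p {p0 e} => x y; rewrite /comb/=; congr (_, _); rewrite /=; ring.
Qed.

Lemma equi_cone_zonorm j (b : bool) s t : (j < n)%N -> 0 <= s -> 0 <= t ->
  N (comb ((-1) ^+ b * s) ((-1) ^+ b * t) (ray (equi j)) (ray (equi j.+1))) =
  (s + t) * (c / tan x0).
Proof.
move=> jn s0 t0.
transitivity (N (comb s t (ray (equi j)) (ray (equi j.+1)))).
  case: b; last by rewrite !mul1r.
  rewrite -[RHS]zonormN /comb /=; congr zonorm; congr (_, _); rewrite /=; ring.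
rewrite (zonorm_cone r equi_sorted equi_half_turn)// !heightE; ring.
Qed.

Let tan_x0_gt0 : 0 < tan x0. Proof. exact: tan_half_step_gt0. Qed.

Let h_gt0 : 0 < c / tan x0. Proof. exact: divr_gt0. Qed.

Lemma equi_area_le (B : set (mR * mR)) : measurable B ->
  (forall p, B p -> N p <= 1) ->
  (mu2 B <= (n%:R * sin (pi / n%:R) * (tan (pi / (2 * n%:R)) / c) ^+ 2)%:E)%E.
Proof.
move=> mB BN; set h := c / tan x0.
pose tri (b : bool) (j : nat) : set (mR * mR) :=
  (fun p : mR * mR =>
     ((-1) ^+ b * cos (equi j) / h * p.1 + (-1) ^+ b * cos (equi j.+1) / h * p.2,
      (-1) ^+ b * sin (equi j) / h * p.1 + (-1) ^+ b * sin (equi j.+1) / h * p.2)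
     : mR * mR) @` closed_triangle (R := R).
have detE (b : bool) j :
    (-1) ^+ b * cos (equi j) / h * ((-1) ^+ b * sin (equi j.+1) / h) -
    (-1) ^+ b * cos (equi j.+1) / h * ((-1) ^+ b * sin (equi j) / h) = sin delta / h ^+ 2.
  have b2 : (-1) ^+ b * (-1) ^+ b = 1 :> R by rewrite -expr2 sqrr_sign.
  rewrite -[sin delta]mul1r -[X in X * sin delta]b2 -(equiS j) sinB.
  by move: ((-1) ^+ b) => e; field; exact: lt0r_neq0.
have d_gt0 : 0 < sin delta / h ^+ 2 by rewrite divr_gt0// exprn_gt0.
have mtri b j : measurable (tri b j).
  apply: measurable_image_linear; last exact: measurable_closed_triangle.
  by rewrite detE lt0r_neq0.
have mutri b j : mu2 (tri b j) = (sin delta / h ^+ 2 / 2)%:E.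
  rewrite /tri mu2_image_linear ?detE ?lt0r_neq0//; last exact: measurable_closed_triangle.
  by rewrite [X in (_ * X)%E]mu2_closed_triangle gtr0_norm.
pose A (j : nat) := tri false j `|` tri true j.
have mA j : measurable (A j) by exact: measurableU.
have muA j : (mu2 (A j) <= (sin delta / h ^+ 2)%:E)%E.
  apply: le_trans (measureU2 _ (mtri _ _) (mtri _ _)) _.
  rewrite [X in (X + _)%E]mutri [X in (_ + X)%E]mutri -EFinD lee_fin; lra.
apply: (@le_trans _ _ (\sum_(j < n) mu2 (A j))%E).
  apply: content_subadditive => // p Bp.
  have [j [s [t [b [jn s0 t0 pE]]]]] := equi_cover p.
  have Np := BN _ Bp; rewrite pE equi_cone_zonorm// -/h in Np.
  rewrite -bigcup_mkord; exists j => //.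
  have : tri b j p.
    exists (s * h, t * h); first by split; [exact: mulr_ge0 (ltW _)|exact: mulr_ge0 (ltW _)|rewrite /= -mulrDl].
    rewrite pE /comb /=; congr (_, _); field; exact: lt0r_neq0.
  by case: b {pE Np} => ?; [right|left].
apply: (@le_trans _ _ (\sum_(j < n) (sin delta / h ^+ 2)%:E)%E).
  exact: lee_sum.
rewrite sumEFin lee_fin sumr_const card_ord -(mulr_natl (_ / _)) /h -/delta -/x0.
rewrite le_eqVlt; apply/orP; left; apply/eqP; field; rewrite !lt0r_neq0//.
Qed.

(** The vertices are those of the unit ball, at distance 1/h from the origin,
    where h = c / tan(pi/(2n)) is the common height. *)
Definition in_polygon (p : R * R) := exists w : 'I_(2 * n) -> R,
  [/\ forall k, 0 <= w k, \sum_k w k = 1,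
      p.1 = \sum_k w k * (tan x0 / c * cos (equi k)) &
      p.2 = \sum_k w k * (tan x0 / c * sin (equi k))].

Lemma in_polygon_zonorm p : in_polygon p -> N p <= 1.
Proof.
move=> [w [w0 w1 p1 p2]].
have crossE i : cross (ray (equi i)) p =
    \sum_k w k * (tan x0 / c * cross (ray (equi i)) (ray (equi k))).
  rewrite /cross p1 p2 !mulr_sumr -sumrB; apply: eq_bigr => k _ /=; ring.
apply: (@le_trans _ _ (\sum_(k < 2 * n) w k * (tan x0 / c * ht k))).
  rewrite /height /zonorm.
  under [leRHS]eq_bigr do rewrite !mulr_sumr.
  rewrite exchange_big /=; apply: ler_sum => i _.
  rewrite crossE (le_trans (ler_wpM2l (ltW c_gt0) (ler_norm_sum _ _ _)))//.
  rewrite mulr_sumr; apply: ler_sum => k _.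
  have tc : 0 < tan x0 / c by rewrite divr_gt0.
  by rewrite normrM (ger0_norm (w0 k)) normrM (ger0_norm (ltW tc)) mulrCA (mulrCA c).
rewrite -w1; apply: ler_sum => k _; rewrite heightE.
rewrite le_eqVlt; apply/orP; left; apply/eqP; field; rewrite !lt0r_neq0//.
Qed.

Lemma in_polygon_convex a b p q : 0 <= a -> 0 <= b -> a + b = 1 ->
  in_polygon p -> in_polygon q -> in_polygon (comb a b p q).
Proof.
move=> a0 b0 ab [w [w0 w1 p1 p2]] [v [v0 v1 q1 q2]].
exists (fun k => a * w k + b * v k); split.
- by move=> k; rewrite addr_ge0 ?mulr_ge0.
- by rewrite big_split /= -!mulr_sumr w1 v1 !mulr1.
- by rewrite /= p1 q1 !mulr_sumr -big_split; apply: eq_bigr => k _; rewrite /= mulrDl !mulrA.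
- by rewrite /= p2 q2 !mulr_sumr -big_split; apply: eq_bigr => k _; rewrite /= mulrDl !mulrA.
Qed.

Lemma in_polygon_vertex k : (k <= 2 * n)%N ->
  in_polygon (tan x0 / c * cos (equi k), tan x0 / c * sin (equi k)).
Proof.
have lt j : (j < 2 * n)%N -> in_polygon (tan x0 / c * cos (equi j), tan x0 / c * sin (equi j)).
  move=> jn; exists (fun k => (k == Ordinal jn)%:R); split.
  - by move=> i; rewrite ler0n.
  - by rewrite (bigD1 (Ordinal jn))//= eqxx big1 ?addr0// => i /negPf ->.
  - rewrite (bigD1 (Ordinal jn))//= eqxx mul1r big1 ?addr0// => i /negPf ->.
    by rewrite mul0r.
  - rewrite (bigD1 (Ordinal jn))//= eqxx mul1r big1 ?addr0// => i /negPf ->.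
    by rewrite mul0r.
rewrite leq_eqVlt => /predU1P[->|]; last exact: lt.
have -> : equi (2 * n) = equi 0 + pi *+ 2.
  by rewrite /equi natrM mulr2n; field; rewrite lt0r_neq0.
by rewrite cosD2pi sinD2pi; apply: lt; rewrite muln_gt0 /= ltnW.
Qed.

Lemma in_polygon_contract a b p q : 0 <= a -> 0 <= b -> a + b <= 1 ->
  in_polygon p -> in_polygon q -> in_polygon (comb a b p q).
Proof.
move=> a0 b0 ab Pp Pq.
(* The origin is the midpoint of two opposite vertices. *)
have P0 : in_polygon (0, 0).
  have := @in_polygon_convex 2^-1 2^-1 _ _ _ _ _ (@in_polygon_vertex 0 _) (@in_polygon_vertex n _).
  rewrite equi_half_turn cosDpi sinDpi /comb /= !mulrN !subrr; apply => //; rewrite ?invr_ge0//.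
  - lra.
  - by rewrite leq_pmull.
have [ab0|ab0] := eqVneq (a + b) 0.
  have [-> ->] : a = 0 /\ b = 0 by split; lra.
  by rewrite /comb !mul0r addr0.
have ab1 : 0 < a + b by rewrite lt_neqAle eq_sym ab0 addr_ge0.
have P1 : in_polygon (comb (a / (a + b)) (b / (a + b)) p q).
  by apply: in_polygon_convex => //; [exact: divr_ge0 (ltW _)|exact: divr_ge0 (ltW _)|rewrite -mulrDl divff].
have := @in_polygon_convex (a + b) (1 - (a + b)) _ _ _ _ _ P1 P0.
have -> : comb (a + b) (1 - (a + b)) (comb (a / (a + b)) (b / (a + b)) p q) (0, 0) = comb a b p q.
  by rewrite /comb /=; congr (_, _); field.
apply; lra.
Qed.

Lemma zonorm_in_polygon p : N p <= 1 -> in_polygon p.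
Proof.
have [j [s [t [b [jn s0 t0 ->]]]]] := equi_cover p.
rewrite equi_cone_zonorm//; set h := c / tan x0 => st.
have h0 : 0 < h by [].
(* The opposite of the m-th vertex is the (m + n)-th one; for m = n this is the
   index 2n, which stands for the vertex 0. *)
have nb m : (m <= n)%N -> exists2 k, (k <= 2 * n)%N &
    (tan x0 / c * ((-1) ^+ b * cos (equi m)), tan x0 / c * ((-1) ^+ b * sin (equi m))) =
    (tan x0 / c * cos (equi k), tan x0 / c * sin (equi k)).
  move=> mn; case: b; last by exists m; rewrite ?mul1r//; exact: leq_trans mn (leq_pmull _ _).
  exists (m + n)%N; first by rewrite mul2n -addnn leq_add2r.
  have -> : equi (m + n) = equi m + pi by rewrite /equi natrD; field; rewrite lt0r_neq0.
  by rewrite cosDpi sinDpi !mulN1r.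
have [k kn kE] := nb j (ltnW jn); have [l ln lE] := nb j.+1 jn.
have Pk := in_polygon_vertex kn; have Pl := in_polygon_vertex ln.
rewrite -kE in Pk; rewrite -lE in Pl.
have := in_polygon_contract (mulr_ge0 s0 (ltW h0)) (mulr_ge0 t0 (ltW h0)) _ Pk Pl.
rewrite -mulrDl => /(_ st); congr in_polygon.
rewrite /comb /=; move: ((-1) ^+ b) => e; rewrite /h.
by congr (_, _); field; rewrite !lt0r_neq0.
Qed.

End Equispaced.

(** * Planes in R^n and their orthonormal bases *)

Section Planes.
Variable R : realType.

Lemma dotC n (x y : 'rV[R]_n) : dot x y = dot y x.
Proof. by apply: eq_bigr => i _; rewrite mulrC. Qed.

Lemma dotDl n (x y z : 'rV[R]_n) : dot (x + y) z = dot x z + dot y z.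
Proof. by rewrite -big_split; apply: eq_bigr => i _; rewrite !mxE mulrDl. Qed.

Lemma dotZl n a (x z : 'rV[R]_n) : dot (a *: x) z = a * dot x z.
Proof. by rewrite mulr_sumr; apply: eq_bigr => i _; rewrite !mxE mulrA. Qed.

Lemma dotDr n (x y z : 'rV[R]_n) : dot z (x + y) = dot z x + dot z y.
Proof. by rewrite !(dotC z) dotDl. Qed.

Lemma dotZr n a (x z : 'rV[R]_n) : dot z (a *: x) = a * dot z x.
Proof. by rewrite !(dotC z) dotZl. Qed.

Lemma dot_ge0 n (x : 'rV[R]_n) : 0 <= dot x x.
Proof. by apply: sumr_ge0 => i _; rewrite -expr2 sqr_ge0. Qed.

Lemma dot_eq0 n (x : 'rV[R]_n) : (dot x x == 0) = (x == 0).
Proof.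
apply/eqP/eqP => [/eqP|->]; last by apply: big1 => i _; rewrite mxE mul0r.
rewrite psumr_eq0 => [/allP x0|i _]; last by rewrite -expr2 sqr_ge0.
apply/rowP => i; rewrite mxE; have := x0 i (mem_index_enum _).
by rewrite /= mulf_eq0 orbb => /eqP.
Qed.

Lemma normalize n (x : 'rV[R]_n) : x != 0 ->
  dot ((Num.sqrt (dot x x))^-1 *: x) ((Num.sqrt (dot x x))^-1 *: x) = 1.
Proof.
move=> x0; rewrite dotZl dotZr mulrA -expr2 exprVn sqr_sqrtr ?dot_ge0// mulVf//.
by rewrite dot_eq0.
Qed.

(** Gram-Schmidt on two vectors of H. *)
Lemma orthonormal_basis_exists n (H : {vspace 'rV[R]_n}) : \dim H = 2%N ->
  exists b, orthonormal_basis H b.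
Proof.
move=> dH.
pose v := vpick H; pose e1 := (Num.sqrt (dot v v))^-1 *: v.
have v0 : v != 0 by rewrite vpick0 -dimv_eq0 dH.
have n1 : dot e1 e1 = 1 by exact: normalize.
have e1H : e1 \in H by rewrite memvZ// memv_pick.
have e10 : e1 != 0 by rewrite -dot_eq0 n1 oner_eq0.
have /subvPn[u uH ue1] : ~~ (H <= <[e1]>)%VS.
  by apply/negP => /dimvS; rewrite dH dim_vline e10.
pose w := u - dot u e1 *: e1; pose e2 := (Num.sqrt (dot w w))^-1 *: w.
have w0 : w != 0.
  by apply: contra ue1; rewrite subr_eq0 => /eqP ->; rewrite memvZ// memv_line.
have n2 : dot e2 e2 = 1 by exact: normalize.
have n12 : dot e1 e2 = 0.
  have we1 : dot w e1 = 0 by rewrite /w -scaleNr dotDl dotZl n1 mulr1 subrr.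
  by rewrite dotC dotZl we1 mulr0.
have e2H : e2 \in H by rewrite memvZ// memvB// memvZ.
exists (e1, e2); split => //=.
apply/eqP; rewrite eqEdim subv_add !memvE in e1H e2H *.
rewrite e1H e2H dH /= ltnNge; apply/negP => d1.
have : (<[e1]> == <[e1]> + <[e2]>)%VS by rewrite eqEdim addvSl dim_vline e10.
move=> /eqP e12.
have : e2 \in <[e1]>%VS by rewrite e12 memvE addvSr.
move=> /vlineP[k ek]; move: n12; rewrite ek dotZr n1 mulr1 => k0.
by have := oner_neq0 R; rewrite -n2 ek k0 scale0r dot_eq0 eqxx.
Qed.

Lemma orthonormal_mem n (H : {vspace 'rV[R]_n}) b x : orthonormal_basis H b ->
  reflect (exists p : R * R, x = p.1 *: b.1 + p.2 *: b.2) (x \in H).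
Proof.
case=> _ _ _ <-; apply: (iffP memv_addP) => [[_ /vlineP[s ->] [_ /vlineP[t ->] ->]]|[p ->]].
  by exists (s, t).
exists (p.1 *: b.1); first by rewrite memvZ// memv_line.
by exists (p.2 *: b.2); rewrite // memvZ// memv_line.
Qed.

(** Replacing (a, b) by its opposite if needed makes a <= 0, and then
    (a, b) = rho (- sin t, cos t) with t in the range of the arc cosine. *)
Lemma polar_form (a b : R) : exists t rho (e : bool),
  [/\ 0 <= t <= pi, 0 <= rho, rho ^+ 2 = a ^+ 2 + b ^+ 2 &
   forall p, p.1 * a + p.2 * b = (-1) ^+ e * rho * cross (ray t) p].
Proof.
wlog a0 : a b / a <= 0 => [hw|].
  have [a0|a0] := leP a 0; first exact: hw.
  have [|t [rho [e [t0 r0 r2 E]]]] := hw (- a) (- b); first by rewrite oppr_le0 ltW.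
  exists t, rho, (~~ e); split => //; first by rewrite r2 !sqrrN.
  by move=> p; rewrite -[LHS]opprK opprD -!mulrN E; case: (e) => /=; ring.
have s0 : 0 <= a ^+ 2 + b ^+ 2 by rewrite addr_ge0 ?sqr_ge0.
pose rho := Num.sqrt (a ^+ 2 + b ^+ 2).
have r0 : 0 <= rho by exact: sqrtr_ge0.
have r2 : rho ^+ 2 = a ^+ 2 + b ^+ 2 by rewrite sqr_sqrtr.
have [rho0|rho0] := eqVneq rho 0.
  have [a00 b00] : a = 0 /\ b = 0.
    move: r2; rewrite rho0 expr0n /= => /eqP; rewrite eq_sym paddr_eq0 ?sqr_ge0// !sqrf_eq0.
    by case/andP=> /eqP -> /eqP ->.
  exists 0, 0, false; split => //; first by rewrite lexx pi_ge0.
    by rewrite a00 b00 !expr0n addr0.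
  by move=> p; rewrite a00 b00; ring.
have rp : 0 < rho by rewrite lt_neqAle eq_sym rho0.
have br : -1 <= b / rho <= 1.
  rewrite -ler_norml normrM normfV (ger0_norm r0) ler_pdivrMr// mul1r.
  by rewrite -(@ler_pXn2r _ 2)// ?nnegrE// real_normK ?num_real// r2 lerDr sqr_ge0.
exists (acos (b / rho)), rho, false; split => //; first by rewrite acos_ge0 ?acos_lepi.
move=> p; rewrite /cross /= acosK ?in_itv//= sin_acos//.
have -> : 1 - (b / rho) ^+ 2 = (- a / rho) ^+ 2.
  have -> : (- a / rho) ^+ 2 = a ^+ 2 / rho ^+ 2 by field.
  by rewrite -[X in X - _](@divff _ (rho ^+ 2)) ?expf_neq0// {1}r2; field.
rewrite sqrtr_sqr ger0_norm; last by rewrite divr_ge0// oppr_ge0.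
by field.
Qed.

Lemma sort_perm n (a : 'I_n -> R) : exists s : 'S_n,
  forall i j : 'I_n, (i <= j)%N -> a (s i) <= a (s j).
Proof.
pose le := [rel i j | a i <= a j].
pose t := sort le (enum 'I_n).
have st : size t == n by rewrite size_sort size_enum_ord.
have /tuple_permP[s ts] : perm_eq (Tuple st) (ord_tuple n).
  by rewrite /= perm_sort.
have le_tr : transitive le by move=> ? ? ?; exact: le_trans.
have srt : sorted le (Tuple st) by apply: sort_sorted => ? ?; exact: le_total.
exists s => i j ij.
have nthE (k : 'I_n) : nth k (Tuple st) k = s k.
  by rewrite ts -tnth_nth tnth_mktuple tnth_ord_tuple.
have := @sorted_leq_nth _ le le_tr (fun x => lexx _) i _ srt i j.
rewrite /= !inE (eqP st) !ltn_ord => /(_ isT isT ij).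
by rewrite nthE (set_nth_default j) ?(eqP st)// nthE.
Qed.

End Planes.

(** * The section by a plane as the ball of a polygonal norm *)

Section SectionFan.
Variable R : realType.
Local Notation mR := (measurableTypeR R).
Local Notation mu2 := (@product_measure1 _ _ mR mR R
  (@lebesgue_measure R) (@lebesgue_measure R)).

(** The default value d serves the index n, where the fan closes up. *)
Definition extend n (a : 'I_n -> R) (d : R) (k : nat) : R :=
  if insub k is Some i then a i else d.

Lemma extend_ord n (a : 'I_n -> R) d (i : 'I_n) : extend a d i = a i.
Proof. by rewrite /extend valK. Qed.

Lemma extend_lt n (a : 'I_n -> R) d k (kn : (k < n)%N) : extend a d k = a (Ordinal kn).
Proof. exact: (extend_ord a d (Ordinal kn)). Qed.

Lemma extend_out n (a : 'I_n -> R) d : extend a d n = d.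
Proof. by rewrite /extend insubF// ltnn. Qed.

(** The polar forms of the coordinate pairs, sorted by angle. *)
Lemma section_fan n (H : {vspace 'rV[R]_n}) b : (0 < n)%N -> orthonormal_basis H b ->
  exists f r (s : 'S_n) (e : 'I_n -> bool),
  [/\ forall i, 0 <= r i,
      forall i j, (i <= j <= n)%N -> f i <= f j,
      f n = f 0 + pi,
      \sum_(0 <= i < n) r i ^+ 2 = 2 &
      forall (i : 'I_n) p, p.1 * b.1 0 (s i) + p.2 * b.2 0 (s i) =
        (-1) ^+ e i * (r i * cross (ray (f i)) p)].
Proof.
move=> n0 [b11 b22 _ _].
have polar (i : 'I_n) : exists q : R * R * bool,
  [/\ 0 <= q.1.1 <= pi, 0 <= q.1.2, q.1.2 ^+ 2 = b.1 0 i ^+ 2 + b.2 0 i ^+ 2 &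
   forall p, p.1 * b.1 0 i + p.2 * b.2 0 i = (-1) ^+ q.2 * (q.1.2 * cross (ray q.1.1) p)].
  have [t [rho [e [t0 r0 r2 E]]]] := polar_form (b.1 0 i) (b.2 0 i).
  by exists (t, rho, e); split => //= p; rewrite E mulrA.
have [q Q] := choice polar.
have [s ss] := sort_perm (fun i => (q i).1.1).
pose a i := (q (s i)).1.1.
exists (extend a (a (Ordinal n0) + pi)), (extend (fun i => (q (s i)).1.2) 0), s, (fun i => (q (s i)).2).
split.
- by move=> i; rewrite /extend; case: insub => // j; have [] := Q (s j).
- move=> i j /andP[ij]; rewrite leq_eqVlt => /predU1P[jn|jn].
    rewrite jn extend_out; move: ij; rewrite jn leq_eqVlt => /predU1P[->|lin].
      by rewrite extend_out.
    rewrite extend_lt; have [/andP[_ ai] _ _ _] := Q (s (Ordinal lin)).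
    by have [/andP[a0 _] _ _ _] := Q (s (Ordinal n0)); rewrite (le_trans ai)// lerDr.
  by rewrite !extend_lt ?(leq_ltn_trans ij jn)// => lin; exact: ss.
- by rewrite extend_out (extend_lt _ _ n0).
- rewrite big_mkord; under eq_bigr => i _ do rewrite extend_ord.
  transitivity (\sum_(i < n) (b.1 0 i ^+ 2 + b.2 0 i ^+ 2)).
    rewrite [RHS](reindex_inj (@perm_inj _ s)); apply: eq_bigr => i _.
    by have [] := Q (s i).
  rewrite big_split /=; have -> : 2 = dot b.1 b.1 + dot b.2 b.2 by rewrite b11 b22.
  by congr (_ + _); apply: eq_bigr => i _; rewrite expr2.
- by move=> i p; rewrite !extend_ord; have [_ _ _ ->] := Q (s i).
Qed.

Lemma signed_fan_zonorm n (b : 'rV[R]_n * 'rV[R]_n) (f r : nat -> R) (s : 'S_n) (e : 'I_n -> bool) p :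
  (forall i, 0 <= r i) ->
  (forall (i : 'I_n) p, p.1 * b.1 0 (s i) + p.2 * b.2 0 (s i) =
        (-1) ^+ e i * (r i * cross (ray (f i)) p)) ->
  \sum_(i < n) `|(p.1 *: b.1 + p.2 *: b.2) 0 i| = zonorm n f r p.
Proof.
move=> r0 E; rewrite /zonorm big_mkord (reindex_inj (@perm_inj _ s)).
by apply: eq_bigr => i _; rewrite !mxE E normrM normr_sign mul1r normrM ger0_norm.
Qed.

Lemma measurable_zonorm_ball n (f r : nat -> R) :
  measurable ([set p | zonorm n f r p <= 1] : set (mR * mR)).
Proof.
have mz : measurable_fun setT (fun p : mR * mR => zonorm n f r p : mR).
  apply: measurable_sum => i; apply: measurable_funM => //.
  apply: (measurableT_comp (@normr_measurable R setT)).
  have := @measurable_linear_form R (- sin (f i)) (cos (f i)).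
  by congr measurable_fun; apply/funext => p; rewrite /cross /=; ring.
rewrite -[X in measurable X]setTI.
have := mz measurableT `]-oo, 1]%classic (measurable_itv _).
by congr measurable; apply/seteqP; split => p /=; rewrite in_itv.
Qed.

Lemma vol2_section n (H : {vspace 'rV[R]_n}) : (0 < n)%N -> \dim H = 2%N ->
  exists b f r (s : 'S_n) (e : 'I_n -> bool),
  [/\ orthonormal_basis H b, forall i, 0 <= r i,
      forall i j, (i <= j <= n)%N -> f i <= f j,
      f n = f 0 + pi & \sum_(0 <= i < n) r i ^+ 2 = 2] /\
  [/\ forall (i : 'I_n) p, p.1 * b.1 0 (s i) + p.2 * b.2 0 (s i) =
        (-1) ^+ e i * (r i * cross (ray (f i)) p),
      forall p, p != 0 -> 0 < zonorm n f r p &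
      vol2 H (section H) = mu2 [set p | zonorm n f r p <= 1]].
Proof.
move=> n0 dH; have [b0 b0P] := orthonormal_basis_exists dH.
pose b := get (orthonormal_basis H).
have bP : orthonormal_basis H b by exact: (getI b0P).
have [f [r [s [e [r0 fs fn r2 E]]]]] := section_fan n0 bP.
exists b, f, r, s, e; split; split => //.
  move=> p p0; rewrite -(signed_fan_zonorm p r0 E) lt_neqAle sumr_ge0// andbT eq_sym.
  apply: contra p0; rewrite psumr_eq0// => /allP x0.
  have z : p.1 *: b.1 + p.2 *: b.2 = 0.
    apply/rowP => i; have /= := x0 i (mem_index_enum _).
    by rewrite normr_eq0 => /eqP ->; rewrite mxE.
  have [b11 b22 b12 _] := bP.
  have := congr1 (dot b.1) z; have := congr1 (dot b.2) z.
  have d0 (x : 'rV[R]_n) : dot x 0 = 0 by apply: big1 => i _; rewrite mxE mulr0.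
  rewrite !dotDr !dotZr b11 b22 (dotC b.2) b12 !d0 !mulr0 !mulr1 addr0 add0r.
  by case: p {x0 z} => x y /= -> ->.
rewrite /vol2 -/b; congr (_ _); apply/seteqP; split => p /=; rewrite /section/= /cross_polytope/=.
  by rewrite (signed_fan_zonorm p r0 E) => -[].
by rewrite -(signed_fan_zonorm p r0 E) => ?; split => //; apply/(orthonormal_mem _ bP); exists p.
Qed.

End SectionFan.

(** * The lower bound and the planes that attain it *)

Section Minimisers.
Variable R : realType.
Local Notation mR := (measurableTypeR R).
Local Notation mu2 := (@product_measure1 _ _ mR mR R
  (@lebesgue_measure R) (@lebesgue_measure R)).

(** The coordinates of the points of H, suitably signed and reordered, are those
    of an equally spaced fan. *)
Definition regular_frame n (H : {vspace 'rV[R]_n}) b (s : 'S_n) (e : 'I_n -> bool) f0 :=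
  orthonormal_basis H b /\ forall (i : 'I_n) p, p.1 * b.1 0 (s i) + p.2 * b.2 0 (s i) =
     (-1) ^+ e i * (Num.sqrt (2 / n%:R) * cross (ray (equi n f0 i)) p).

Lemma vol2_section_min n (H : {vspace 'rV[R]_n}) : (1 < n)%N -> \dim H = 2%N ->
  ((min_volume R n)%:E <= vol2 H (section H))%E /\
  (vol2 H (section H) = (min_volume R n)%:E ->
   exists b s e f0, regular_frame H b s e f0).
Proof.
move=> n1 dH; have n0 := ltnW n1.
have [b [f [r [s [e [[bP r0 fs fn r2] [E pos ->]]]]]]] := vol2_section n0 dH.
have [le eq] := fan_min_area r0 fs fn pos n1 (measurable_zonorm_ball n f r) (fun p => id) r2.
split => // /eq[gap rE]; exists b, s, e, (f 0); split => // i p.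
rewrite E rE ?ltn_ord//; do 5!congr (_ _); suff -> : f i = equi n (f 0) i by [].
have: (i <= n)%N by exact: ltnW.
elim: (i : nat) => [_|k IH kn]; first by rewrite /equi mul0r addr0.
by rewrite -[LHS](subrK (f k)) gap// (IH (ltnW kn)) /equi -natr1; ring.
Qed.

Lemma orthonormal_coords n (H : {vspace 'rV[R]_n}) b p : orthonormal_basis H b ->
  dot b.1 (p.1 *: b.1 + p.2 *: b.2) = p.1 /\ dot b.2 (p.1 *: b.1 + p.2 *: b.2) = p.2.
Proof.
case=> b11 b22 b12 _; rewrite !dotDr !dotZr b11 b22 (dotC b.2) b12.
by rewrite !mulr0 !mulr1 addr0 add0r.
Qed.

Lemma edist_orthonormal n (H : {vspace 'rV[R]_n}) b (p q : R * R) : orthonormal_basis H b ->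
  Defs.edist (p.1 *: b.1 + p.2 *: b.2) (q.1 *: b.1 + q.2 *: b.2) =
  Num.sqrt ((p.1 - q.1) ^+ 2 + (p.2 - q.2) ^+ 2).
Proof.
case=> b11 b22 b12 _; rewrite /Defs.edist.
have -> : p.1 *: b.1 + p.2 *: b.2 - (q.1 *: b.1 + q.2 *: b.2) =
  (p.1 - q.1) *: b.1 + (p.2 - q.2) *: b.2.
  by rewrite !scalerBl opprD addrACA.
by rewrite !dotDl !dotZl !dotDr !dotZr b11 b22 (dotC b.2) b12; congr Num.sqrt; ring.
Qed.

(** The isometry sends a point of H to its coordinates in the basis b; the image
    of the section is the unit ball of the norm of the fan. *)
Lemma regular_frame_isometric n (H : {vspace 'rV[R]_n}) b s e f0 : (1 < n)%N ->
  regular_frame H b s e f0 ->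
  exists2 P : set 'rV[R]_2, regular_polygon (2 * n) P & isometric (section H) P.
Proof.
move=> n1 [bP E].
have nn : 0 < n%:R :> R by rewrite ltr0n ltnW.
pose c : R := Num.sqrt (2 / n%:R).
have c0 : 0 < c by rewrite sqrtr_gt0 divr_gt0.
have sumE p := signed_fan_zonorm p (fun _ => ltW c0) E.
pose rad : R := tan (pi / (2 * n%:R)) / c.
have rad0 : 0 < rad by rewrite divr_gt0 ?tan_half_step_gt0.
pose V (k : 'I_(2 * n)) : 'rV[R]_2 := 0 + rad *: dir (f0 + 2 * pi * k%:R / (2 * n)%:R).
have V0 k : V k 0 0 = rad * cos (equi n f0 k).
  rewrite !mxE /= add0r; congr (_ * cos _); rewrite /equi natrM; field; exact: lt0r_neq0.
have V1 k : V k 0 1 = rad * sin (equi n f0 k).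
  rewrite !mxE /= add0r; congr (_ * sin _); rewrite /equi natrM; field; exact: lt0r_neq0.
exists (convex_hull V); first by exists 0, rad, f0.
pose F (x : 'rV[R]_n) : 'rV[R]_2 := \row_j (if j == 0 then dot b.1 x else dot b.2 x).
have FE p : F (p.1 *: b.1 + p.2 *: b.2) = \row_j (if j == 0 then p.1 else p.2).
  by have [e1 e2] := orthonormal_coords p bP; apply/rowP => j; rewrite !mxE e1 e2.
have sumV w : \sum_k w k *: V k =
    \row_j (if j == 0 then \sum_k w k * (rad * cos (equi n f0 k))
            else \sum_k w k * (rad * sin (equi n f0 k))) :> 'rV[R]_2.
  apply/rowP => j; rewrite summxE !mxE.
  case: (unliftP 0 j) => [j'|] ->; last by apply: eq_bigr => k _; rewrite mxE V0.
  by rewrite (ord1 j'); apply: eq_bigr => k _; rewrite mxE -V1; congr (_ * V k _ _); exact: val_inj.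
exists F => [x y [_ xH] [_ yH]|].
  have [p ->] := orthonormal_mem x bP xH; have [q ->] := orthonormal_mem y bP yH.
  rewrite (edist_orthonormal _ _ bP) !FE /Defs.edist /dot; congr Num.sqrt.
  by rewrite big_ord_recl big_ord1 !mxE /= !expr2.
apply/seteqP; split => [_ [x [xB xH] <-]|_ [w [w0 w1 ->]]].
  have [p xE] := orthonormal_mem x bP xH; rewrite xE in xB *.
  rewrite /cross_polytope /= sumE in xB.
  have [w [w0 w1 p1 p2]] := zonorm_in_polygon n1 c0 xB.
  by exists w; split => //; rewrite FE sumV p1 p2.
pose p : R * R := (\sum_k w k * (rad * cos (equi n f0 k)), \sum_k w k * (rad * sin (equi n f0 k))).
have pN : zonorm n (equi n f0) (fun=> c) p <= 1.
  by apply: in_polygon_zonorm => //; exists w.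
exists (p.1 *: b.1 + p.2 *: b.2); last by rewrite FE sumV.
split; first by rewrite /cross_polytope /mkset sumE.
by apply/(orthonormal_mem _ bP); exists p.
Qed.

End Minimisers.

(** * The volume of the model section *)

Section Model.
Variable R : realType.
Local Notation mR := (measurableTypeR R).
Local Notation mu2 := (@product_measure1 _ _ mR mR R
  (@lebesgue_measure R) (@lebesgue_measure R)).

Lemma dot2 (x y : 'rV[R]_2) : dot x y = x 0 0 * y 0 0 + x 0 1 * y 0 1.
Proof.
rewrite /dot big_ord_recl big_ord1; congr (_ + x _ _ * y _ _); exact: val_inj.
Qed.

Lemma TmapE n (x : 'rV[R]_2) (k : 'I_n) :
  Tmap n x 0 k = cos (k.+1%:R * pi / n%:R) * x 0 0 + sin (k.+1%:R * pi / n%:R) * x 0 1.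
Proof. by rewrite mxE dot2 !mxE. Qed.

Lemma mem_Timage n (y : 'rV[R]_n) : y \in Timage R n -> exists x, y = Tmap n x.
Proof. by move=> /memv_imgP[x _ ->]; exists x; rewrite lfunE. Qed.

Lemma dim_Timage n : (1 < n)%N -> \dim (Timage R n) = 2%N.
Proof.
case: n => [|[|m]] // _; set n := m.+2.
have nn : 0 < n%:R :> R by rewrite ltr0n.
rewrite /Timage limg_dim_eq ?dimvf ?dim_matrix//.
apply/eqP; rewrite capfv -subv0; apply/subvP => x; rewrite memv_ker lfunE /= => /eqP Tx.
have T (k : 'I_n) : Tmap n x 0 k = 0 by rewrite Tx mxE.
have := T ord_max; rewrite TmapE /= mulrAC divff ?lt0r_neq0// mul1r cospi sinpi mul0r addr0 mulN1r.
move=> /eqP; rewrite oppr_eq0 => /eqP x0.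
have := T ord0; rewrite TmapE x0 mulr0 add0r mul1r => /eqP; rewrite mulf_eq0.
have s0 : 0 < sin (pi / n%:R : R).
  rewrite sin_gt0_pi// divr_gt0 ?pi_gt0//= ltr_pdivrMr// ltr_pMr ?pi_gt0//.
  by rewrite ltr1n.
rewrite (negbTE (lt0r_neq0 s0)) /= => /eqP x1.
rewrite memv0; apply/eqP/rowP => j; rewrite mxE.
case: (unliftP 0 j) => [j'|] -> //; rewrite (ord1 j') -x1; congr (x _ _); exact: val_inj.
Qed.

(** The hypotheses say that the columns of W = ((a, b), (c, d)) are orthonormal
    for the form G = ((A, B), (B, S)), so that det(W)^2 det(G) = 1, while
    det(G) <= (tr(G)/2)^2.  For the model plane the trace is plain, as
    cos^2 + sin^2 = 1, whereas the entries of G would need trigonometric sums. *)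
Lemma gram_det_ge (a b c d A B S m : R) : 0 < m -> A + S = m ->
  A * a ^+ 2 + 2 * B * a * c + S * c ^+ 2 = 1 ->
  A * b ^+ 2 + 2 * B * b * d + S * d ^+ 2 = 1 ->
  A * a * b + B * (a * d + b * c) + S * c * d = 0 ->
  a * d - b * c != 0 /\ `|a * d - b * c|^-1 <= m / 2.
Proof.
move=> m0 AS Q1 Q2 Q12; set D := a * d - b * c.
have DE : D ^+ 2 * (A * S - B ^+ 2) = 1.
  transitivity ((A * a ^+ 2 + 2 * B * a * c + S * c ^+ 2) * (A * b ^+ 2 + 2 * B * b * d + S * d ^+ 2)
     - (A * a * b + B * (a * d + b * c) + S * c * d) ^+ 2); first by rewrite /D; ring.
  by rewrite Q1 Q2 Q12; ring.
have D0 : D != 0.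
  by apply/eqP => D0; move: DE; rewrite D0 expr0n mul0r => /eqP; rewrite eq_sym oner_eq0.
split => //; have nD : 0 < `|D| by rewrite normr_gt0.
have m2 : 0 <= m / 2 by lra.
rewrite -(@ler_pXn2r _ 2)// ?nnegrE ?invr_ge0//.
rewrite exprVn real_normK ?num_real//.
have -> : D ^- 2 = A * S - B ^+ 2 by apply: (mulfI (expf_neq0 2 D0)); rewrite divff ?expf_neq0.
have := sqr_ge0 B; have := sqr_ge0 (A - S); rewrite -AS; nra.
Qed.

(** An orthonormal basis of the model plane is T w1, T w2, and in the coordinates
    w the section is the ball of an equally spaced fan with unit weights; the
    Jacobian of the change of coordinates is bounded by [gram_det_ge]. *)
Lemma vol2_Timage_le n : (1 < n)%N ->
  (vol2 (Timage R n) (section (Timage R n)) <= (min_volume R n)%:E)%E.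
Proof.
move=> n1; have nn : 0 < n%:R :> R by rewrite ltr0n ltnW.
have [b0 b0P] := orthonormal_basis_exists (dim_Timage n1).
rewrite /vol2; set b := get _.
have bP : orthonormal_basis (Timage R n) b by exact: (getI b0P).
have [b11 b22 b12 bT] := bP.
have [w1 b1E] : exists x, b.1 = Tmap n x.
  by apply: mem_Timage; rewrite -bT; apply: (subvP (addvSl _ _)); exact: memv_line.
have [w2 b2E] : exists x, b.2 = Tmap n x.
  by apply: mem_Timage; rewrite -bT; apply: (subvP (addvSr _ _)); exact: memv_line.
pose th (k : nat) : R := k.+1%:R * pi / n%:R.
pose A := \sum_(k < n) cos (th k) ^+ 2.
pose S := \sum_(k < n) sin (th k) ^+ 2.
pose B := \sum_(k < n) cos (th k) * sin (th k).
have AS : A + S = n%:R.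
  rewrite -big_split /=; under eq_bigr do rewrite cos2Dsin2.
  by rewrite sumr_const card_ord.
have dotT x y : dot (Tmap n x) (Tmap n y) =
    A * x 0 0 * y 0 0 + B * (x 0 0 * y 0 1 + y 0 0 * x 0 1) + S * x 0 1 * y 0 1.
  rewrite /dot /A /B /S !mulr_suml -!big_split; apply: eq_bigr => k _.
  by rewrite !TmapE /= -/(th k); ring.
have [|||D0 Dle] := @gram_det_ge (w1 0 0) (w2 0 0) (w1 0 1) (w2 0 1) A B S _ nn AS.
- by have := b11; rewrite b1E dotT => e; rewrite -[RHS]e; ring.
- by have := b22; rewrite b2E dotT => e; rewrite -[RHS]e; ring.
- by rewrite -[RHS]b12 b1E b2E dotT.
(* The form <dir(t), .> is det(e(t - pi/2), .), whence the initial angle. *)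
pose N := zonorm n (equi n (pi / n%:R - pi / 2)) (fun _ => 1 : R).
pose Bn : set (mR * mR) := [set p | N p <= 1].
have mB : measurable Bn by exact: measurable_zonorm_ball.
have -> : [set p : R * R | section (Timage R n) (p.1 *: b.1 + p.2 *: b.2)] =
   (fun p => (w1 0 0 * p.1 + w2 0 0 * p.2, w1 0 1 * p.1 + w2 0 1 * p.2)) @^-1` Bn.
  have E p : \sum_(i < n) `|(p.1 *: b.1 + p.2 *: b.2) 0 i| =
     N (w1 0 0 * p.1 + w2 0 0 * p.2, w1 0 1 * p.1 + w2 0 1 * p.2).
    rewrite /N /zonorm big_mkord; apply: eq_bigr => i _.
    have -> : (p.1 *: b.1 + p.2 *: b.2) 0 i = p.1 * Tmap n w1 0 i + p.2 * Tmap n w2 0 i.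
      by rewrite b1E b2E !mxE.
    rewrite mul1r !TmapE /cross /=.
    have -> : equi n (pi / n%:R - pi / 2) i = th i - pi / 2.
      by rewrite /equi /th -natr1; field; exact: lt0r_neq0.
    rewrite cosBpihalf sinBpihalf -/(th i); congr `|_|; ring.
  apply/seteqP; split => p /=; rewrite /section /= /cross_polytope /mkset E.
    by case.
  by split => //; apply/(orthonormal_mem _ bP); exists p.
rewrite [X in (X <= _)%E]mu2_linear//.
have area := @equi_area_le R n (pi / n%:R - pi / 2) 1 n1 ltr01 Bn mB (fun p => id).
pose x0 : R := pi / (2 * n%:R).
have c0 : 0 < cos x0 by exact: cos_half_step_gt0.
have K0 : 0 <= n%:R * sin (pi / n%:R) * (tan x0 / 1) ^+ 2.
  rewrite mulr_ge0 ?sqr_ge0// mulr_ge0// sin_ge0_pi// divr_ge0 ?pi_ge0//=.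
  by rewrite ler_pdivrMr// ler_peMr ?pi_ge0// ler1n ltnW.
apply: (@le_trans _ _ (`|w1 0 0 * w2 0 1 - w2 0 0 * w1 0 1|^-1%:E *
   (n%:R * sin (pi / n%:R) * (tan x0 / 1) ^+ 2)%:E)%E).
  by apply: lee_wpmul2l => //; rewrite lee_fin invr_ge0.
rewrite -EFinM lee_fin; apply: (le_trans (ler_wpM2r K0 Dle)).
rewrite le_eqVlt; apply/orP; left; apply/eqP.
have -> : pi / n%:R = x0 *+ 2 by rewrite /x0 mulr2n; field; exact: lt0r_neq0.
rewrite sin_mulr2n /min_volume -/x0 /tan -mulr_natl; field; exact: lt0r_neq0.
Qed.

End Model.

(** * Uniqueness up to signs and permutations *)

Section Uniqueness.
Variable R : realType.

(** Up to signs and order, the coordinates of the points of H run through one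
    and the same plane, as the initial angle f0 and the scale are absorbed by the
    parameter q. *)
Lemma regular_frame_mem n (H : {vspace 'rV[R]_n}) b s e f0 (x : 'rV[R]_n) : (1 < n)%N ->
  regular_frame H b s e f0 ->
  x \in H <-> exists q : R * R, forall i : 'I_n,
    (-1) ^+ e i * x 0 (s i) = cross (ray (i%:R * (pi / n%:R))) q.
Proof.
move=> n1 [bP E]; have nn : 0 < n%:R :> R by rewrite ltr0n ltnW.
set c := Num.sqrt (2 / n%:R) in E.
have c0 : 0 < c by rewrite sqrtr_gt0 divr_gt0.
have sg (i : 'I_n) : (-1) ^+ e i * (-1) ^+ e i = 1 :> R by rewrite -expr2 sqrr_sign.
have coord p i : (-1) ^+ e i * (p.1 *: b.1 + p.2 *: b.2) 0 (s i) =
    c * cross (ray (equi n f0 i)) p.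
  by rewrite !mxE E mulrA sg mul1r.
split=> [/(orthonormal_mem _ bP)[p ->]|[q xq]].
  exists (c * (cos f0 * p.1 + sin f0 * p.2), c * (cos f0 * p.2 - sin f0 * p.1)) => i.
  by rewrite coord /cross /equi /= sinD cosD; ring.
pose p : R * R := ((cos f0 * q.1 - sin f0 * q.2) / c, (sin f0 * q.1 + cos f0 * q.2) / c).
apply/(orthonormal_mem _ bP); exists p; apply/rowP => k.
rewrite -[k](permKV s); set i := (s^-1)%g k.
have := coord p i; have -> : c * cross (ray (equi n f0 i)) p = cross (ray (i%:R * (pi / n%:R))) q.
  rewrite /cross /equi /p /= sinD cosD.
  transitivity ((cos f0 ^+ 2 + sin f0 ^+ 2) *
    (cos (i%:R * (pi / n%:R)) * q.2 - sin (i%:R * (pi / n%:R)) * q.1)).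
    by field; exact: lt0r_neq0.
  by rewrite cos2Dsin2 mul1r.
by rewrite -xq => /(congr1 (fun z => (-1) ^+ e i * z)); rewrite !mulrA sg !mul1r => ->.
Qed.

(** Both planes are carried onto that common plane by signed permutations of the
    coordinates; phi is the first followed by the inverse of the second. *)
Lemma regular_frame_equivalent n (H K : {vspace 'rV[R]_n}) b s e f0 b' s' e' f0' :
  (1 < n)%N -> regular_frame H b s e f0 -> regular_frame K b' s' e' f0' ->
  signed_perm_equivalent H K.
Proof.
move=> n1 RH RK.
pose t : 'S_n := ((s'^-1) * s)%g.
pose d k := e ((s'^-1)%g k) (+) e' ((s'^-1)%g k).
pose phi (x : 'rV[R]_n) := coord_reflection d (col_perm t x).
have phiE x i : (-1) ^+ e' i * phi x 0 (s' i) = (-1) ^+ e i * x 0 (s i).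
  rewrite !mxE /d /t permM permK signr_addb mulrA mulrCA mulrA.
  by rewrite -mulrA -expr2 sqrr_sign mulr1.
have phi_mem x : (phi x \in K) <-> (x \in H).
  rewrite (regular_frame_mem x n1 RH) (regular_frame_mem (phi x) n1 RK).
  by split=> -[q Q]; exists q => i; rewrite -Q phiE.
exists d, t; apply/seteqP; split => [y yK|_ [x xH <-]]; last exact/phi_mem.
have phiK : phi (col_perm (t^-1)%g (coord_reflection d y)) = y.
  by apply/rowP => k; rewrite !mxE permK mulrA -expr2 sqrr_sign mul1r.
exists (col_perm (t^-1)%g (coord_reflection d y)) => //=.
by apply/phi_mem; rewrite phiK.
Qed.

End Uniqueness.

Theorem theorem1 (R : realType) (n : nat) (hn : (3 <= n)%N) :
  [/\ forall H : {vspace 'rV[R]_n}, \dim H = 2%N ->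
        ((min_volume R n)%:E <= vol2 H (section H))%E,
      forall H : {vspace 'rV[R]_n}, \dim H = 2%N ->
        vol2 H (section H) = (min_volume R n)%:E ->
        exists2 P : set 'rV[R]_2,
          regular_polygon (2 * n) P & isometric (section H) P,
      minimising (Timage R n) /\
        vol2 (Timage R n) (section (Timage R n)) = (min_volume R n)%:E &
      forall H K : {vspace 'rV[R]_n}, minimising H -> minimising K ->
        signed_perm_equivalent H K].
Proof.
have n1 : (1 < n)%N by exact: ltnW.
have dT := dim_Timage R n1.
have TE : vol2 (Timage R n) (section (Timage R n)) = (min_volume R n)%:E.
  by apply/eqP; rewrite eq_le vol2_Timage_le// (vol2_section_min n1 dT).1.
have min_frame (H : {vspace 'rV[R]_n}) : minimising H ->
    exists b s e f0, regular_frame H b s e f0.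
  move=> [dH Hmin]; apply: (vol2_section_min n1 dH).2.
  by apply/eqP; rewrite eq_le (vol2_section_min n1 dH).1 andbT -TE Hmin.
split.
- by move=> H dH; exact: (vol2_section_min n1 dH).1.
- move=> H dH /(vol2_section_min n1 dH).2 [b [s [e [f0 fr]]]].
  exact: regular_frame_isometric n1 fr.
- by split => //; split => // K dK; rewrite TE; exact: (vol2_section_min n1 dK).1.
- move=> H K /min_frame[b [s [e [f0 RH]]]] /min_frame[b' [s' [e' [f0' RK]]]].
  exact: regular_frame_equivalent n1 RH RK.
Qed.
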